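(* Let $T^+=(T^+(s))_{s\in[0,t]}$ be a telegraph meander with parameters $\lambda>0$, $c>0$, $t>0$. Then the law of $T^+(t)$ conditioned on the number $N(t)$ of Poisson events is as follows. If $n=0$, it is the unit mass at $ct$. If $n=2k$ with $k\in\mathbb{N}$, $$\mathsf{P}\{T^+(t)\in dx\mid N(t)=2k\}=2kx\,\frac{(c^2t^2-x^2)^{k-1}}{(ct)^{2k}}\,\mathsf{1}_{[0,ct)}(x)\,dx.$$ If $n=2k+1$ with $k\in\mathbb{N}_0$, $$\mathsf{P}\{T^+(t)\in dx\mid N(t)=2k+1\}=\frac{ct+(2k+1)x}{(ct)^{2k+1}}\,\frac{(c^2t^2-x^2)^k}{ct+x}\,\mathsf{1}_{[0,ct)}(x)\,dx.$$
   Context: Let $N$ be a homogeneous Poisson process of rate $\lambda>0$, and let $V(0)$ be independent of $N$ and uniformly distributed on $\{-c,c\}$, $c>0$. Set $V(s)=V(0)(-1)^{N(s)}$ and $T(s)=\int_0^sV(u)\,du$ (telegraph process). The telegraph meander $T^+$ is $T$ on $[0,t]$ conditioned on $\{\min_{0\le s\le t}T(s)\ge0\}$. Its conditional law given $N(t)=n$ is $\mathsf{P}\{T^+(t)\in A\mid N(t)=n\}=\mathsf{P}\{T(t)\in A\mid \min_{0\le s\le t}T(s)\ge0,\ N(t)=n\}$ for Borel $A$. $\mathbb{N}=\{1,2,\dots\}$, $\mathbb{N}_0=\mathbb{N}\cup\{0\}$. *)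

(* Defs.v *)
From HB Require Import structures.
From mathcomp Require Import all_boot all_order all_algebra.
From mathcomp Require Import all_classical all_reals all_analysis.

Set Implicit Arguments.
Unset Strict Implicit.
Unset Printing Implicit Defensive.

Import Order.TTheory GRing.Theory Num.Theory.
Import numFieldNormedType.Exports.

Local Open Scope classical_set_scope.
Local Open Scope ring_scope.

Section telegraph.
Context (d : measure_display) (Omega : measurableType d) (R : realType).
Variable P : probability Omega R.
(* X is the initial velocity V(0). *)
Implicit Types (X : {RV P >-> R}) (N : R -> {RV P >-> nat}).

(* Times are the nonnegative reals: the values of N at negative indices are
   irrelevant. Since paths are nondecreasing, the truncated subtraction of nat
   is the genuine increment. The topology of nat is discrete. *)
Record poisson_process (lambda : R) N : Prop := PoissonProcess {
  poisson_start : forall w, N 0 w = 0%N ;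
  poisson_nondecreasing : forall w s u, 0 <= s -> s <= u -> (N s w <= N u w)%N ;
  poisson_right_continuous :
    forall w s, 0 <= s -> N u w @[u --> s^'+] --> N s w ;
  poisson_independent_increments :
    forall (m : nat) (s : nat -> R) (B : nat -> set nat),
      0 <= s 0%N -> {homo s : i j / (i <= j)%N >-> i <= j} ->
      P (\bigcap_(i < m) [set w | B i (N (s i.+1) w - N (s i) w)%N]) =
      (\prod_(i < m) P [set w | B i (N (s i.+1) w - N (s i) w)%N])%E ;
  poisson_increment_law :
    forall (s u : R) (k : nat), 0 <= s -> s < u ->
      P [set w | (N u w - N s w)%N = k] =
      (poisson_pmf (lambda * (u - s)) k)%:E
}.

Definition sigma_process N : set (set Omega) :=
  <<s \bigcup_(s in [set s : R | 0 <= s]) g_sigma_algebra_preimage (N s) >>.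

Definition independent_of_process X N : Prop :=
  forall (A : set R) (E : set Omega), measurable A -> sigma_process N E ->
    P (X @^-1` A `&` E) = (P (X @^-1` A) * P E)%E.

Definition uniform_sign (c : R) X : Prop :=
  P [set w | X w = c] = (2^-1)%:E /\ P [set w | X w = - c] = (2^-1)%:E.

Definition velocity X N (s : R) (w : Omega) : R := X w * (-1) ^+ N s w.

Definition telegraph X N (s : R) (w : Omega) : R :=
  \int[lebesgue_measure]_(u in `[0, s]) velocity X N u w.

(* The minimum is written as the infimum in the extended reals, which has no
   default value; it is attained because the paths of T are continuous. *)
Definition stays_nonnegative X N (t : R) : set Omega :=
  [set w |
    (0 <= ereal_inf [set (telegraph X N s w)%:E | s in `[0%R, t]%classic])%E].

Definition cond_prob (A B : set Omega) : \bar R :=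
  (fine (P (A `&` B)) / fine (P B))%:E.

(* P{T^+(t) \in A | N(t) = n} *)
Definition meander_law X N (t : R) (n : nat) (A : set R) : \bar R :=
  cond_prob (telegraph X N t @^-1` A)
            (stays_nonnegative X N t `&` [set w | N t w = n]).

End telegraph.

(* Main.v *)
Require Import Defs.
From HB Require Import structures.
From mathcomp Require Import all_boot all_order all_algebra.
From mathcomp Require Import all_classical all_reals all_analysis.
From mathcomp Require Import measurable_realfun ring lra.
Import Order.TTheory GRing.Theory Num.Theory.
Import numFieldNormedType.Exports.
Set Implicit Arguments.
Unset Strict Implicit.
Unset Printing Implicit Defensive.
Local Open Scope classical_set_scope.
Local Open Scope ring_scope.

(* Let S be the telegraph process with unit speed started upwards, and let U and
   D be the times it has spent moving up and down, so that U + D = t and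
   S = U - D. For d <= t/2 and u = t - d,
     P(S >= 0 on [0,t], N(t) = n, D <= d)
       = e^(-lambda t) lambda^n u^a / a! * d^b / b!, a = n/2, b = n - n/2 (integer
   division), by induction on n: when n is even D is frozen since the last jump,
   when n is odd U is, and conditioning on the last jump shows that the
   u-derivative (n even) or the d-derivative (n odd) of the left-hand side divided
   by e^(-lambda t) lambda^n is the same quantity for n - 1. The derivative is
   handled through increments over [t, t+h], with errors whose sum over a
   subdivision tends to 0; only the independence of the path up to t and the
   increment N(t+h) - N(t) is needed, and it is obtained by approximating the path
   event by constraints on dyadic meshes. Since a jump-free initial period forces
   V(0) = c, dividing by the value at d = t/2 gives the tail
   P(T >= x) = (1 + x/ct)^a (1 - x/ct)^b of the meander, whose derivative is the
   stated density. *)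

(** * Alternating integrals of counting paths *)

Section counting_path.
Context (R : realType).
Implicit Types (p : R -> nat) (s u t h : R).

Definition counting_path p :=
  p 0 = 0%N /\ forall s u, 0 <= s -> s <= u -> (p s <= p u)%N.

(** For [p] a path of [N] this is the unit-speed process started upwards; the telegraph process is
    [V0] times it, see [telegraphE]. *)
Definition alternating_integral p s : R :=
  \int[lebesgue_measure]_(u in `[0, s]) (-1) ^+ p u.

Local Notation S := alternating_integral.

Lemma measurable_alternating p (D : set R) : counting_path p -> measurable D ->
  D `<=` [set u | 0 <= u] -> measurable_fun D (fun u => (-1) ^+ p u : R).
Proof.
move=> [p0 pmono] mD D0 _ B mB.
(* Freezing the path at 0 on negative times makes it monotone on the whole line, so its level sets
   are intervals. *)
pose q u := p (Num.max 0 u).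
have qmono : forall u v, u <= v -> (q u <= q v)%N.
  move=> u v uv; apply: pmono; first by rewrite le_max lexx.
  by rewrite ge_max le_max lexx/= le_max uv orbT.
rewrite (_ : _ `&` _ = \bigcup_(n in [set n : nat | B ((-1) ^+ n)])
    (D `&` [set u | q u = n])); last first.
  apply/seteqP; split=> [u [Du Bu]|u [n /= Bn [Du /= qu]]].
    exists (p u) => //; split=> //=; rewrite /q max_r//; exact: D0.
  by split => //=; move: Bn; rewrite -qu /q max_r//; exact: D0.
apply: bigcup_measurable => n _; apply: measurableI => //.
apply: is_interval_measurable => x y /= xn yn z /andP[xz zy] /=.
by apply/eqP; rewrite eqn_leq; apply/andP; split; [rewrite -yn|rewrite -xn]; exact: qmono.
Qed.

Lemma integrable_alternating p s u : counting_path p -> 0 <= s ->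
  lebesgue_measure.-integrable `[s, u] (EFin \o (fun v => (-1) ^+ p v : R)).
Proof.
move=> pP s0.
have su0 : `[s, u] `<=` [set v | 0 <= v].
  by move=> v /=; rewrite in_itv/= => /andP[/(le_trans s0)].
apply: measurable_bounded_integrable => //.
- by rewrite /= lebesgue_measure_itv/= lte_fin; case: ifP => // _; rewrite -EFinB ltry.
- exact: measurable_alternating.
- exists 1; split=> // M M1 v _ /=.
  by rewrite normrX normrN1 expr1n ltW.
Qed.

Lemma alternating_integral0 p : S p 0 = 0.
Proof. by rewrite /S set_itv1 Rintegral_set1. Qed.

Lemma alternating_integralB p s u : counting_path p -> 0 <= s -> s <= u ->
  S p u - S p s = \int[lebesgue_measure]_(v in `[s, u]) (-1) ^+ p v.
Proof.
move=> pP s0 su; rewrite /S.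
rewrite Rintegral_itvB ?bnd_simp//; last exact: integrable_alternating.
rewrite Rintegral_itv_obnd_cbnd//.
apply: (integrableS _ _ _ (@integrable_alternating p s u _ _)) => //.
exact: subset_itv_oc_cc.
Qed.

Lemma alternating_integral_lip p s u : counting_path p -> 0 <= s -> s <= u ->
  `|S p u - S p s| <= u - s.
Proof.
move=> pP s0 su; rewrite alternating_integralB//.
apply: (le_trans (le_normr_Rintegral _ _)) => //.
  exact: integrable_alternating.
rewrite (_ : (fun _ => _) = (fun=> 1)); last first.
  by apply/funext => v; rewrite normrX normrN1 expr1n.
rewrite Rintegral_cst//= mul1r lebesgue_measure_itv/= lte_fin.
by case: ifP => [_|]; [rewrite -EFinB|rewrite subr_ge0].
Qed.

Lemma alternating_integral_const p s u : counting_path p -> 0 <= s -> s <= u ->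
  p s = p u -> S p u - S p s = (-1) ^+ p u * (u - s).
Proof.
move=> pP s0 su psu; rewrite alternating_integralB//.
rewrite (_ : Rintegral _ _ _ =
    \int[lebesgue_measure]_(v in `[s, u]) ((-1) ^+ p u)).
  rewrite Rintegral_cst//= lebesgue_measure_itv/= lte_fin.
  case: ltP => // us; have -> : u = s by apply/le_anti/andP.
  by rewrite subrr.
apply: eq_Rintegral => v; rewrite inE/= in_itv/= => /andP[sv vu].
congr (_ ^+ _); apply/eqP; rewrite eqn_leq -{2}psu.
by case: pP => _ pm; rewrite !pm// (le_trans s0).
Qed.

Lemma alternating_integral_le p s u : counting_path p -> 0 <= s -> s <= u ->
  S p u <= S p s + (u - s).
Proof.
move=> pP s0 su; rewrite -lerBlDl.
exact: le_trans (ler_norm _) (alternating_integral_lip pP s0 su).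
Qed.

Lemma alternating_integral_ge p s u : counting_path p -> 0 <= s -> s <= u ->
  S p s - (u - s) <= S p u.
Proof.
move=> pP s0 su; have := alternating_integral_lip pP s0 su.
by rewrite ler_norml => /andP[]; rewrite lerBrDl.
Qed.

(* A cell on which the path does not jump contributes no error, and there are at
   most [p (s j)] cells with a jump. *)
Lemma riemann_sum_error p h (s : nat -> R) : counting_path p -> 0 <= h ->
  s 0%N = 0 -> (forall i, s i <= s i.+1) -> (forall i, s i.+1 - s i <= h) ->
  forall j, `|S p (s j) - \sum_(i < j) (s i.+1 - s i) * (-1) ^+ p (s i)|
             <= 2 * h * (p (s j))%:R.
Proof.
move=> pP h0 s0 smono sh.
have s_ge0 i : 0 <= s i by elim: i => [|i IH]; [rewrite s0|exact: le_trans IH _].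
elim=> [|j IH].
  by rewrite big_ord0 s0 alternating_integral0 subrr normr0 mulr_ge0// mulr_ge0.
rewrite big_ord_recr/=.
set A := S p (s j) - _ in IH.
have -> : S p (s j.+1) - (\sum_(i < j) (s i.+1 - s i) * (-1) ^+ p (s i) +
    (s j.+1 - s j) * (-1) ^+ p (s j)) =
  A + (S p (s j.+1) - S p (s j) - (s j.+1 - s j) * (-1) ^+ p (s j)).
  by rewrite /A; ring.
have [e|ne] := eqVneq (p (s j)) (p (s j.+1)).
  rewrite (alternating_integral_const pP _ _ e)// e mulrC subrr addr0 -e.
  exact: IH.
have lt : (p (s j) < p (s j.+1))%N.
  by rewrite ltn_neqAle ne/=; apply: pP.2.
apply: (le_trans (ler_normD _ _)).
apply: (@le_trans _ _ (2 * h * (p (s j))%:R + 2 * h)).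
  apply: lerD => //; apply: (le_trans (ler_normB _ _)).
  rewrite normrM normrX normrN1 expr1n mulr1.
  rewrite (_ : 2 * h = h + h); last by ring.
  apply: lerD.
    exact: le_trans (alternating_integral_lip pP (s_ge0 _) (smono _)) (sh _).
  by rewrite ger0_norm ?subr_ge0.
rewrite -[X in _ + X <= _]mulr1 -mulrDr ler_wpM2l ?mulr_ge0//.
by rewrite -(natrD _ _ 1) ler_nat addn1.
Qed.

End counting_path.

(** * Path events over a short time step, and their description on dyadic meshes *)

Section path_event.
Context (R : realType).
Implicit Types (p : R -> nat) (s u t h y : R) (n m : nat).
Local Notation S := alternating_integral.

(* The last condition says that the time spent moving downwards, which is
   [(t - S p t) / 2], is at most [y]. *)
Definition path_event n t y p :=
  [/\ p t = n, forall s, 0 <= s -> s <= t -> 0 <= S p s & t - 2 * y <= S p t].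

(** Down time never decreases, so a bound on it at [t + h] already holds at [t]. *)
Lemma path_event_restrict n t h y p : counting_path p -> 0 <= t -> 0 <= h ->
  path_event n (t + h) y p -> path_event (p t) t y p.
Proof.
move=> pP t0 h0 [_ S0 Sy]; split=> //.
  by move=> s s0 st; apply: S0 => //; lra.
have tth : t <= t + h by lra.
by have := alternating_integral_le pP t0 tth; lra.
Qed.

(** Down time grows by at most [h]. The bound on [y + h] gives [S p t >= t - 2 * y >= h], so even a
    path that only descends after [t] stays nonnegative. *)
Lemma path_event_extend n t h y p : counting_path p -> 0 <= t -> 0 <= h ->
  2 * (y + h) <= t + h -> path_event n t y p ->
  path_event (p (t + h)) (t + h) (y + h) p.
Proof.
move=> pP t0 h0 yh [_ S0 Sy]; split=> //.
  move=> s s0 sth; have [st|/ltW ts] := leP s t; first exact: S0.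
  by have := alternating_integral_ge pP t0 ts; lra.
have tth : t <= t + h by lra.
by have := alternating_integral_ge pP t0 tth; lra.
Qed.

(** Lowering the down-time bound by [h] below [t / 2] keeps the path at height at least [2 * h] at
    time [t]; lowering it by [h] below [y] leaves room for [h] more down time. *)
Lemma path_event_extend_interior n t h y p : counting_path p -> 0 <= t -> 0 <= h ->
  path_event n t (Num.min y (t / 2) - h) p -> path_event (p (t + h)) (t + h) y p.
Proof.
move=> pP t0 h0 [_ S0 Sy].
have y1 : Num.min y (t / 2) <= y by rewrite ge_min lexx.
have y2 : Num.min y (t / 2) <= t / 2 by rewrite ge_min lexx orbT.
split=> //.
  move=> s s0 sth; have [st|/ltW ts] := leP s t; first exact: S0.
  by have := alternating_integral_ge pP t0 ts; lra.
have tth : t <= t + h by lra.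
by have := alternating_integral_ge pP t0 tth; lra.
Qed.

(** Without a jump after [t] and with [n] even the path only rises there, so its down time is
    frozen. *)
Lemma path_event_even n t h y p : counting_path p -> 0 <= t -> 0 <= h ->
  ~~ odd n -> p (t + h) = n -> path_event n t y p -> path_event n (t + h) y p.
Proof.
move=> pP t0 h0 nev pth [pt S0 Sy].
have E s : t <= s -> s <= t + h -> S p s = S p t + (s - t).
  move=> ts sth.
  have ps : p t = p s.
    have s0 : 0 <= s by lra.
    by apply/eqP; rewrite eqn_leq pP.2//= pt -pth pP.2.
  apply/eqP; rewrite addrC -subr_eq (alternating_integral_const pP t0 ts ps).
  by rewrite -ps pt -signr_odd (negbTE nev) mul1r.
split=> //.
  move=> s s0 sth; have [st|/ltW ts] := leP s t; first exact: S0.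
  by rewrite E//; have := S0 _ t0 (lexx _); lra.
rewrite E ?lexx//; lra.
Qed.

(** Without a jump after [t] and with [n] odd the path only descends there, so exactly [h] of its
    down time falls after [t]. *)
Lemma path_event_odd n t h y p : counting_path p -> 0 <= t -> 0 <= h ->
  odd n -> p t = n -> path_event n (t + h) (y + h) p -> path_event n t y p.
Proof.
move=> pP t0 h0 nodd pt [pth S0 Sy]; split=> //.
  by move=> s s0 st; apply: S0 => //; lra.
have tth : t <= t + h by lra.
have := alternating_integral_const pP t0 tth (etrans pt (esym pth)).
by rewrite pth -signr_odd nodd expr1; lra.
Qed.

(** The mesh is an infinite sequence, constant equal to [t] from index [2 ^ M] on, which fits the
    sequences of times in [poisson_process]. *)
Definition dyadic t (M i : nat) : R := t * (minn i (2 ^ M))%:R / (2 ^ M)%:R.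

Lemma dyadic0 t M : dyadic t M 0 = 0.
Proof. by rewrite /dyadic min0n mulr0 mul0r. Qed.

Lemma dyadic_last t M i : (2 ^ M <= i)%N -> dyadic t M i = t.
Proof. by move=> Mi; rewrite /dyadic (minn_idPr _)// mulfK// pnatr_eq0 expn_eq0. Qed.

Lemma dyadic_homo t M : 0 <= t -> {homo dyadic t M : i j / (i <= j)%N >-> i <= j}.
Proof.
move=> t0 i j ij; rewrite /dyadic ler_wpM2r ?invr_ge0// ler_wpM2l// ler_nat.
by rewrite leq_min geq_minr geq_min ij.
Qed.

Lemma dyadic_le t M i : 0 <= t -> dyadic t M i <= t.
Proof.
move=> t0; rewrite -[leRHS](@dyadic_last t M (maxn i (2 ^ M))) ?leq_maxr//.
by apply: dyadic_homo => //; rewrite leq_maxl.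
Qed.

Lemma dyadic_ge0 t M i : 0 <= t -> 0 <= dyadic t M i.
Proof. by move=> t0; rewrite -(@dyadic0 t M) dyadic_homo. Qed.

Lemma dyadic_step t M i : 0 <= t -> dyadic t M i.+1 - dyadic t M i <= t / (2 ^ M)%:R.
Proof.
move=> t0; rewrite /dyadic -mulrBl -mulrBr ler_wpM2r ?invr_ge0// -[leRHS]mulr1.
rewrite ler_wpM2l// lerBlDr -(natrD _ 1) ler_nat.
by rewrite add1n -minnSS leq_min geq_minl geq_min leqnSn orbT.
Qed.

Lemma dyadic_refine t M k i : dyadic t (M + k) (i * 2 ^ k) = dyadic t M i.
Proof.
by rewrite /dyadic expnD -minnMl !natrM mulrA -mulf_div divff ?mulr1// pnatr_eq0 expn_eq0.
Qed.

(* Constraint on the values of a path on a dyadic mesh, relaxed by the error of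
   the Riemann sums. *)
Definition mesh_event n t y M (a : nat -> nat) :=
  let sum j := \sum_(i < j) (dyadic t M i.+1 - dyadic t M i) * (-1) ^+ a i in
  let err := 2 * (t / (2 ^ M)%:R) * n%:R in
  [/\ a (2 ^ M)%N = n, forall j, 0 <= sum j + err &
      t - 2 * y <= sum (2 ^ M)%N + err].

Lemma le_add_dyadicP (x y K : R) : 0 <= K ->
  (forall M, x <= y + K / (2 ^ M)%:R) -> x <= y.
Proof.
move=> K0 H; apply/ler_addgt0Pr => e e0.
pose M := Num.truncn (K / e).
apply: (le_trans (H M)); rewrite lerD2l ler_pdivrMr ?ltr0n ?expn_gt0//.
rewrite mulrC -ler_pdivrMr//.
have := truncnS_gt (K / e); rewrite -/M => /ltW/le_trans; apply.
by rewrite ler_nat ltn_expl.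
Qed.

(** This turns an event about uncountably many times into a countable intersection of constraints on
    finitely many values. Riemann sums are within the allowed error of [S p], and every time is
    within one mesh width of a mesh point; conversely the error vanishes as [M] grows. *)
Lemma path_eventP n t y p : counting_path p -> 0 <= t ->
  path_event n t y p <-> forall M, mesh_event n t y M (p \o dyadic t M).
Proof.
move=> pP t0.
have err M j : p t = n -> `|S p (dyadic t M j) -
   \sum_(i < j) (dyadic t M i.+1 - dyadic t M i) * (-1) ^+ p (dyadic t M i)|
    <= 2 * (t / (2 ^ M)%:R) * n%:R.
  move=> pt; have h0 : 0 <= t / (2 ^ M)%:R by rewrite divr_ge0.
  apply: (@le_trans _ _ (2 * (t / (2 ^ M)%:R) * (p (dyadic t M j))%:R)).
    apply: riemann_sum_error => //.
    - exact: dyadic0.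
    - by move=> i; rewrite dyadic_homo.
    - by move=> i; exact: dyadic_step.
  by rewrite ler_wpM2l ?mulr_ge0// ler_nat -pt pP.2 ?dyadic_ge0 ?dyadic_le.
split=> [[pt S0 Sy] M|H].
  split; rewrite /= ?dyadic_last//.
    move=> j; have := err M j pt; rewrite ler_norml => /andP[_].
    by have := S0 _ (dyadic_ge0 M j t0) (dyadic_le M j t0); lra.
  by have := err M (2 ^ M)%N pt; rewrite ler_norml dyadic_last// => /andP[_]; lra.
have pt : p t = n by have [] := H 0%N; rewrite /= dyadic_last.
(* In units of the mesh width [t / 2 ^ M], the Riemann sum and the relaxation in [mesh_event] cost
   [2 * n] each, and moving to a mesh point costs 1. *)
have K0 : 0 <= t * (4 * n%:R + 1) by rewrite mulr_ge0// addr_ge0// mulr_ge0.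
split=> //.
  move=> s s0 st; apply: (le_add_dyadicP K0) => M.
  have M0 : 0 < (2 ^ M)%:R :> R by rewrite ltr0n expn_gt0.
  have [t_eq0|tn0] := eqVneq t 0.
    have -> : s = 0 by apply/le_anti; rewrite s0 andbT -t_eq0.
    by rewrite alternating_integral0 t_eq0 !mul0r addr0.
  have tp : 0 < t by rewrite lt_neqAle eq_sym tn0.
  (* [x] is [s] in mesh units, and [j] is the index of the last mesh point not after [s]. *)
  pose x := s / t * (2 ^ M)%:R.
  pose j := Num.truncn x.
  have x0 : 0 <= x by rewrite mulr_ge0// divr_ge0.
  have /andP[jx xj] := truncn_itv x0.
  have sE : s = t * x / (2 ^ M)%:R.
    by rewrite /x; field; rewrite !gt_eqF.
  have x1 : x <= (2 ^ M)%:R by rewrite /x ler_piMl// ler_pdivrMr// mul1r.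
  have jM : (j <= 2 ^ M)%N by rewrite -(ler_nat R) (le_trans jx).
  have dj : dyadic t M j = t * j%:R / (2 ^ M)%:R.
    by rewrite /dyadic (minn_idPl jM).
  have djs : dyadic t M j <= s.
    by rewrite dj sE ler_wpM2r ?invr_ge0// ler_wpM2l.
  have sdj : s - dyadic t M j <= t / (2 ^ M)%:R.
    rewrite dj sE -mulrBl -mulrBr ler_wpM2r ?invr_ge0// -[leRHS]mulr1 ler_wpM2l//.
    by rewrite lerBlDr addrC natr1 ltW.
  have := alternating_integral_ge pP (dyadic_ge0 M j t0) djs.
  have := err M j pt; rewrite ler_norml => /andP[+ _].
  have [_ /(_ j) + _] := H M; rewrite /=.
  have -> : t * (4 * n%:R + 1) / (2 ^ M)%:R =
    2 * (2 * (t / (2 ^ M)%:R) * n%:R) + t / (2 ^ M)%:R by ring.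
  lra.
apply: (le_add_dyadicP K0) => M.
have := err M (2 ^ M)%N pt; rewrite ler_norml dyadic_last// => /andP[+ _].
have [_ _] := H M; rewrite /=.
have -> : t * (4 * n%:R + 1) / (2 ^ M)%:R =
    2 * (2 * (t / (2 ^ M)%:R) * n%:R) + t / (2 ^ M)%:R by ring.
have : 0 <= t / (2 ^ M)%:R by rewrite divr_ge0.
lra.
Qed.

End path_event.

(** * Independence of the past path and the next Poisson increment *)

Section poisson_paths.
Context (d : measure_display) (Omega : measurableType d) (R : realType).
Context (P : probability Omega R) (lambda : R) (N : R -> {RV P >-> nat}).
Hypothesis N_poisson : poisson_process lambda N.
Implicit Types (s u t h y : R) (n m k : nat) (E : set Omega) (w : Omega).

Lemma poisson_counting_path w : counting_path (fun s => N s w).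
Proof.
split; first exact: poisson_start N_poisson w.
by move=> s u; exact: (poisson_nondecreasing N_poisson).
Qed.

Lemma sigma_process_level s n : 0 <= s -> sigma_process N [set w | N s w = n].
Proof.
move=> s0; apply: sub_sigma_algebra; exists s => //=.
by exists [set n] => //; rewrite setTI.
Qed.

Lemma sigma_process_measurable E : sigma_process N E -> measurable E.
Proof.
apply: smallest_sub; first exact: sigma_algebra_measurable.
move=> A [s _ [B mB <-]]; exact: measurable_funPT.
Qed.

Lemma measurable_level s n : measurable [set w | N s w = n].
Proof. exact: (measurable_funPTI (N s) (I : measurable [set n])). Qed.

Lemma measurable_increment s u k : measurable [set w | (N u w - N s w)%N = k].
Proof.
rewrite (_ : [set _ | _] = \bigcup_n ([set w | N s w = n] `&`
    \bigcup_(m in [set m | (m - n)%N = k]) [set w | N u w = m])); last first.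
  apply/seteqP; split=> [w /= wk|w [n _ [/= wn [m /= mk wm]]]].
    by exists (N s w) => //; split => //; exists (N u w).
  by rewrite /= wn wm.
apply: bigcup_measurable => n _; apply: measurableI; first exact: measurable_level.
by apply: bigcup_measurable => m _; exact: measurable_level.
Qed.

(** As paths start at 0, prescribing the values on the mesh amounts to prescribing the increments.
    The product formula with and without the additional increment up to [u] then gives the
    factorisation. *)
Lemma mesh_atom_independent (s : nat -> R) L u k w0 :
  s 0%N = 0 -> {homo s : i j / (i <= j)%N >-> i <= j} -> s L <= u ->
  let V := [set w | forall i, (i <= L)%N -> N (s i) w = N (s i) w0] in
  let I := [set w | (N u w - N (s L) w)%N = k] in
  P (V `&` I) = (P V * P I)%E.
Proof.
move=> s0 smono sLu V I.
pose s' i := if (i <= L)%N then s i else u.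
pose B i : set nat :=
  if (i < L)%N then [set (N (s i.+1) w0 - N (s i) w0)%N] else [set k].
have s'0 : 0 <= s' 0%N by rewrite /s' leq0n s0.
have s'mono : {homo s' : i j / (i <= j)%N >-> i <= j}.
  move=> i j ij; rewrite /s'; case: leqP => iL; case: leqP => jL //.
  - exact: smono.
  - by rewrite (le_trans _ sLu)// smono.
  - by move: (leq_trans iL ij); rewrite ltnNge jL.
pose W i := [set w | B i (N (s' i.+1) w - N (s' i) w)%N].
have VE : V = \bigcap_(i < L) W i.
  apply/seteqP; split=> [w Vw i /= iL|w Ww].
    by rewrite /W /B /s' /= iL (ltnW iL) /= !Vw// ltnW.
  (* Monotonicity of the paths is what lets a truncated difference determine the next value. *)
  elim=> [_|i IH iL]; first by rewrite s0 !(poisson_start N_poisson).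
  have := Ww i iL; rewrite /W /B /s' /= iL (ltnW iL) IH ?(ltnW iL)//= => eqd.
  have si0 : 0 <= s i by rewrite -s0 smono.
  have sii : s i <= s i.+1 by rewrite smono.
  have := poisson_nondecreasing N_poisson w0 si0 sii.
  have := poisson_nondecreasing N_poisson w si0 sii.
  rewrite IH ?(ltnW iL)// => h1 h2.
  by rewrite -(subnK h1) eqd subnK.
have IE : I = W L by rewrite /W /B /s' leqnn ltnn.
have VIE : V `&` I = \bigcap_(i < L.+1) W i.
  rewrite VE IE; apply/seteqP; split=> [w [VW WL] i /=|w H].
    by rewrite ltnS leq_eqVlt => /orP[/eqP ->//|]; exact: VW.
  by split=> [i /= iL|]; apply: H => //=; exact: leqW.
rewrite VIE (poisson_independent_increments N_poisson _ B s'0 s'mono).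
rewrite big_ord_recr/= -(poisson_independent_increments N_poisson _ B s'0 s'mono).
by rewrite -VE IE.
Qed.

(** On [F] all mesh values are at most [n], so [F] is a finite disjoint union of the atoms of
    [mesh_atom_independent]. *)
Lemma mesh_event_independent t M n (F : set Omega) : 0 <= t ->
  F `<=` [set w | N t w = n] ->
  (forall w w', (forall i, N (dyadic t M i) w = N (dyadic t M i) w') -> F w -> F w') ->
  sigma_process N F /\
  forall u k, t <= u -> let I := [set w | (N u w - N t w)%N = k] in
    P (F `&` I) = (P F * P I)%E.
Proof.
move=> t0 Fn Fdet.
pose L := (2 ^ M)%N.
pose V (a : {ffun 'I_L.+1 -> 'I_n.+1}) :=
  [set w | forall i : 'I_L.+1, N (dyadic t M i) w = a i].
pose D := [set a | exists w, V a w /\ F w].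
have dN a w w' : V a w -> V a w' -> forall i, N (dyadic t M i) w = N (dyadic t M i) w'.
  move=> aw aw' i; have [iL|Li] := leqP i L.
    have iL' : (i < L.+1)%N by [].
    by rewrite (aw (Ordinal iL')) (aw' (Ordinal iL')).
  rewrite !dyadic_last ?(ltnW Li)// -(@dyadic_last _ t M L)//.
  by rewrite (aw ord_max) (aw' ord_max).
have FE : F = \bigcup_(a in D) V a.
  apply/seteqP; split=> [w Fw|w [a [w0 [aw0 Fw0]] aw]]; last first.
    exact: Fdet (dN a w0 w aw0 aw) Fw0.
  pose a := [ffun i : 'I_L.+1 => inord (N (dyadic t M i) w) : 'I_n.+1].
  suff aw : V a w by exists a => //; exists w.
  move=> i; rewrite ffunE inordK// ltnS -(Fn _ Fw).
  by apply: (poisson_nondecreasing N_poisson); rewrite ?dyadic_ge0 ?dyadic_le.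
have Dfin : finite_set D by exact: finite_finset.
have trivV J : trivIset D (fun a => V a `&` J).
  move=> a b _ _ [w [[aw _] [bw _]]]; apply/ffunP => i; apply/val_inj.
  by rewrite /= -aw -bw.
have sV a : sigma_process N (V a).
  rewrite (_ : V a = \bigcap_(i in [set: 'I_L.+1])
      [set w | N (dyadic t M i) w = a i]); last first.
    by apply/seteqP; split=> w H i; [move=> _; exact: H|exact: H].
  pose G := \bigcup_(s in [set s : R | 0 <= s]) g_sigma_algebra_preimage (N s).
  apply: (@fin_bigcap_measurable _ (g_sigma_algebraType G)) => // i _.
  exact: sigma_process_level (dyadic_ge0 _ _ t0).
have mV a := sigma_process_measurable (sV a).
split.
  rewrite FE.
  pose G := \bigcup_(s in [set s : R | 0 <= s]) g_sigma_algebra_preimage (N s).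
  by apply: (@fin_bigcup_measurable _ (g_sigma_algebraType G)) => // i _; exact: sV.
move=> u k tu I.
rewrite FE setI_bigcupl measure_fin_bigcup//; last first.
  by move=> a _; apply: measurableI => //; exact: measurable_increment.
rewrite measure_fin_bigcup//; last first.
  by move=> a b Da Db [w [aw bw]]; apply: (trivV setT) => //; exists w.
rewrite ge0_mule_fsuml//; apply: eq_fsbigr => a; rewrite inE => -[w0 [aw0 _]].
have -> : V a = [set w | forall i, (i <= L)%N ->
    N (dyadic t M i) w = N (dyadic t M i) w0].
  apply/seteqP; split=> [w aw i _|w H i]; first exact: dN aw aw0 i.
  by rewrite H ?leq_ord// aw0.
have tE : dyadic t M L = t by rewrite dyadic_last.
have := @mesh_atom_independent (dyadic t M) L u k w0 (dyadic0 t M) (dyadic_homo M t0).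
by rewrite tE; apply.
Qed.

Definition meander_event n t y : set Omega :=
  [set w | path_event n t y (fun s => N s w)].

(** The event is the decreasing limit of events determined on a mesh, and the product formula passes
    to the limit by continuity from above. *)
Lemma meander_event_independent n t y : 0 <= t ->
  sigma_process N (meander_event n t y) /\
  forall u k, t <= u -> let I := [set w | (N u w - N t w)%N = k] in
    P (meander_event n t y `&` I) = (P (meander_event n t y) * P I)%E.
Proof.
move=> t0.
(* Imposing all levels up to [M] makes [K] decreasing; since the meshes are nested, [K M] still
   depends only on the values at level [M]. *)
pose K M := [set w | forall k, (k <= M)%N ->
  mesh_event n t y k ((fun s => N s w) \o dyadic t k)].
have EK : meander_event n t y = \bigcap_M K M.
  apply/seteqP; split=> [w /(path_eventP n y (poisson_counting_path w) t0) H M _ k _|w H].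
    exact: H.
  apply/(path_eventP n y (poisson_counting_path w) t0) => M; exact: (H M).
have indep M : sigma_process N (K M) /\
  forall u k, t <= u -> let I := [set w | (N u w - N t w)%N = k] in
    P (K M `&` I) = (P (K M) * P I)%E.
  apply: (@mesh_event_independent t M n) => //.
    by move=> w /(_ 0%N (leq0n _)) [] /=; rewrite dyadic_last.
  move=> w w' ww' Kw k kM; move: (Kw k kM).
  rewrite (_ : _ \o _ = (fun s => N s w') \o dyadic t k)//.
  apply/funext => i /=; have := ww' (i * 2 ^ (M - k))%N.
  by rewrite -{1 3}(subnKC kM) dyadic_refine.
have mK M := sigma_process_measurable (indep M).1.
have niK J : nonincreasing_seq (fun M => K M `&` J).
  move=> M M' MM'; apply/subsetPset => w [Kw Jw]; split=> // k kM.
  exact/Kw/(leq_trans kM).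
have lim J : measurable J -> P (K M `&` J) @[M --> \oo] --> P (\bigcap_M K M `&` J).
  move=> mJ; have -> : \bigcap_M K M `&` J = \bigcap_M (K M `&` J).
    apply/seteqP; split=> [w [Kw Jw] M _|w H]; first by split=> //; exact: Kw.
    by split=> [M _|]; [case: (H M I)|case: (H 0%N I)].
  apply: (@nonincreasing_cvg_mu _ _ _ P (fun M => K M `&` J)) => //.
  - by rewrite (le_lt_trans (probability_le1 _ _)) ?ltry//; exact: measurableI.
  - by move=> M; exact: measurableI.
  - by apply: bigcapT_measurable => M; exact: measurableI.
split.
  rewrite EK.
  pose G := \bigcup_(s in [set s : R | 0 <= s]) g_sigma_algebra_preimage (N s).
  by apply: (@bigcapT_measurable _ (g_sigma_algebraType G)) => M; have [] := indep M.
move=> u k tu I; have mI : measurable I by exact: measurable_increment.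
rewrite EK; apply/esym/(cvg_unique _ _ (lim I mI)) => //.
rewrite (_ : (fun M => _) = (fun M => P (K M) * P I)%E); last first.
  by apply/funext => M; rewrite (indep M).2.
apply: cvgeZr; first exact: fin_num_measure.
by have := lim setT measurableT; under eq_fun do rewrite setIT; rewrite setIT.
Qed.

End poisson_paths.

(** * Divided powers, and functions with second-order increments *)

Section divided_powers.
Context (R : realType).
Implicit Types (x y u h : R) (a n : nat).

Definition divided_power a x : R := x ^+ a / a`!%:R.

Lemma divided_power_ge0 a x : 0 <= x -> 0 <= divided_power a x.
Proof. by move=> x0; rewrite divr_ge0// exprn_ge0. Qed.

Lemma divided_power_gt0 a x : 0 < x -> 0 < divided_power a x.
Proof. by move=> x0; rewrite divr_gt0 ?exprn_gt0// ltr0n fact_gt0. Qed.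

Lemma divided_power_le a x y : 0 <= x -> x <= y ->
  divided_power a x <= divided_power a y.
Proof.
move=> x0 xy; rewrite ler_wpM2r ?invr_ge0//.
by rewrite lerXn2r// nnegrE (le_trans x0).
Qed.

Lemma divided_powerS0 a : divided_power a.+1 0 = 0.
Proof. by rewrite /divided_power expr0n mul0r. Qed.

(** Mean value bound for a function whose derivative is [divided_power a]: in the factorisation of
    [y ^+ a.+1 - x ^+ a.+1] each of the [a.+1] summands is at least [x ^+ a]. *)
Lemma divided_powerS_ge a x y : 0 <= x -> x <= y ->
  (y - x) * divided_power a x <= divided_power a.+1 y - divided_power a.+1 x.
Proof.
move=> x0 xy; have y0 := le_trans x0 xy.
rewrite /divided_power -mulrBl subrXX factS natrM invfM !mulrA.
rewrite ler_wpM2r ?invr_ge0// ler_pdivlMr// -!mulrA ler_wpM2l ?subr_ge0//.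
rewrite mulr_natr -[X in _ *+ X]card_ord -sumr_const; apply: ler_sum => i _.
rewrite -[in leLHS](subnK (leq_ord i)) exprD /= ler_wpM2r ?exprn_ge0//.
by rewrite lerXn2r.
Qed.

Lemma divided_powerS_le a x y : 0 <= x -> x <= y ->
  divided_power a.+1 y - divided_power a.+1 x <= (y - x) * divided_power a y.
Proof.
move=> x0 xy; have y0 := le_trans x0 xy.
rewrite /divided_power -mulrBl subrXX factS natrM invfM !mulrA.
rewrite ler_wpM2r ?invr_ge0// ler_pdivrMr// -!mulrA ler_wpM2l ?subr_ge0//.
rewrite mulr_natr -[X in _ <= _ *+ X]card_ord -sumr_const; apply: ler_sum => i _.
rewrite -[in leRHS](subnK (leq_ord i)) exprD /= ler_wpM2l ?exprn_ge0//.
by rewrite lerXn2r.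
Qed.

(* With [t = u + v], this is [expR (lambda * t) / lambda ^+ n] times the
   probability that there are [n] jumps, that the path stays nonnegative on [0, t]
   and that its down time is at most [v]; see [meander_closed_form]. *)
Definition two_phase_weight n u v : R :=
  divided_power n./2 u * divided_power (uphalf n) v.

Lemma two_phase_weight_le n u v u' v' : 0 <= u -> 0 <= v -> u <= u' -> v <= v' ->
  two_phase_weight n u v <= two_phase_weight n u' v'.
Proof.
move=> u0 v0 uu vv; apply: ler_pM; rewrite ?divided_power_ge0 ?divided_power_le//.
Qed.

(* The bound on the increment summed over a subdivision of mesh [h] telescopes to
   [h * (g b - g a)]. *)
Lemma eq_of_small_increments (f g : R -> R) x y : x <= y ->
  (forall u v, x <= u -> u < v -> v <= y ->
     `|f v - f u| <= (v - u) * (g v - g u)) ->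
  f y = f x.
Proof.
move=> xy H.
apply/eqP; rewrite -subr_eq0 -normr_le0.
have [->|xny] := eqVneq x y; first by rewrite subrr normr0.
have {}xy : x < y by rewrite lt_neqAle xny.
have K0 : 0 <= (y - x) * (g y - g x).
  by apply: le_trans (H x y (lexx _) xy (lexx _)).
apply: (le_add_dyadicP K0) => M; rewrite add0r.
have M0 : 0 < (2 ^ M)%:R :> R by rewrite ltr0n expn_gt0.
pose h := (y - x) / (2 ^ M)%:R.
have h0 : 0 < h by rewrite divr_gt0// subr_gt0.
suff /(_ (2 ^ M)%N (leqnn _)) : forall i, (i <= 2 ^ M)%N ->
    `|f (x + i%:R * h) - f x| <= h * (g (x + i%:R * h) - g x).
  have -> : x + (2 ^ M)%:R * h = y by rewrite /h; field; rewrite gt_eqF.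
  by move=> /le_trans; apply; rewrite mulrAC.
elim=> [_|i IH iM]; first by rewrite mul0r addr0 !subrr normr0 mulr0.
have yE : y = x + (2 ^ M)%:R * h by rewrite /h; field; rewrite gt_eqF.
have l1 : x <= x + i%:R * h by rewrite lerDl mulr_ge0// ltW.
have l2 : x + i%:R * h < x + i.+1%:R * h.
  by rewrite ltrD2l ltr_pM2r// ltr_nat.
have l3 : x + i.+1%:R * h <= y.
  by rewrite [leRHS]yE lerD2l ler_pM2r// ler_nat.
have := H _ _ l1 l2 l3.
have -> : x + i.+1%:R * h - (x + i%:R * h) = h by rewrite -natr1; ring.
have := IH (ltnW iM).
set p := x + i%:R * h; set q := x + i.+1%:R * h => h1 h2.
have -> : f q - f x = (f p - f x) + (f q - f p) by ring.
by apply: (le_trans (ler_normD _ _)); lra.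
Qed.

End divided_powers.

(** * One-step recursion for the meander probabilities *)

Section meander_recursion.
Context (d : measure_display) (Omega : measurableType d) (R : realType).
Context (P : probability Omega R) (lambda : R) (N : R -> {RV P >-> nat}).
Hypothesis lambda_gt0 : 0 < lambda.
Hypothesis N_poisson : poisson_process lambda N.
Implicit Types (s u t h y : R) (n m k : nat) (E F : set Omega) (w : Omega).

Local Notation ev := (meander_event N).
Local Notation pr E := (fine (P E)).
Local Notation incr t h k := [set w | (N (t + h) w - N t w)%N = k].

Lemma measurable_meander_event n t y : 0 <= t -> measurable (ev n t y).
Proof.
move=> t0; apply: (@sigma_process_measurable _ _ _ P N).
by have [] := meander_event_independent N_poisson n y t0.
Qed.

Lemma fine_probability_le E F : measurable E -> measurable F -> E `<=` F ->
  pr E <= pr F.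
Proof.
by move=> mE mF EF; rewrite fine_le ?fin_num_measure// le_measure ?inE.
Qed.

Lemma fine_probability_setU_le E F : measurable E -> measurable F ->
  pr (E `|` F) <= pr E + pr F.
Proof.
move=> mE mF; rewrite -fineD ?fin_num_measure//.
by rewrite fine_le ?fin_numD ?fin_num_measure//; [exact: measurableU|exact: measureU2].
Qed.

Lemma fine_probability_setU E F : measurable E -> measurable F ->
  E `&` F = set0 -> pr (E `|` F) = pr E + pr F.
Proof.
by move=> mE mF EF; rewrite measureU// fineD ?fin_num_measure.
Qed.

Lemma probability_incr t h k : 0 <= t -> 0 < h ->
  pr (incr t h k) = (lambda * h) ^+ k / k`!%:R * expR (- (lambda * h)).
Proof.
move=> t0 h0; rewrite (poisson_increment_law N_poisson)//=; last by rewrite ltrDl.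
by rewrite /poisson_pmf addrAC subrr add0r mulr_gt0.
Qed.

Lemma probability_meander_incr n t y h k : 0 <= t -> 0 < h ->
  pr (ev n t y `&` incr t h k) = pr (ev n t y) * pr (incr t h k).
Proof.
move=> t0 h0; have [_ ->] := meander_event_independent N_poisson n y t0.
  rewrite fineM ?fin_num_measure//; first exact: measurable_meander_event.
  exact: measurable_increment.
by rewrite lerDl ltW.
Qed.

(** With [x = lambda * h], the bound [expR (- x) >= 1 - x] gives
    [1 - expR (- x) * (1 + x) <= x ^+ 2]. *)
Lemma probability_incr_ge2 t h : 0 <= t -> 0 < h ->
  pr (~` (incr t h 0 `|` incr t h 1)) <= (lambda * h) ^+ 2.
Proof.
move=> t0 h0; have m k := measurable_increment N t (t + h) k.
rewrite probability_setC; last exact: measurableU.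
rewrite fineB ?fin_num_measure//; last exact: measurableU.
rewrite fine_probability_setU//; last first.
  by apply/seteqP; split=> // w [/= ->].
rewrite !probability_incr// expr0 expr1 !fact0 factS fact0 muln1 divr1 mul1r divr1.
have := expR_ge1Dx (- (lambda * h)).
set x := lambda * h; set e := expR _; have x0 : 0 <= x by rewrite mulr_ge0// ltW.
move=> xe /=; have : (1 - x) * (1 + x) <= e * (1 + x) by rewrite ler_wpM2r ?addr_ge0.
lra.
Qed.

(** Splits according to whether the step contains no jump, one jump, or more; the last case
    contributes only the quadratic term. *)
Lemma step_le m t h y y0 y1 : 0 <= t -> 0 < h ->
  (forall w, ev m.+1 (t + h) y w -> N t w = m.+1 -> ev m.+1 t y0 w) ->
  (forall w, ev m.+1 (t + h) y w -> N t w = m -> ev m t y1 w) ->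
  pr (ev m.+1 (t + h) y) <=
    expR (- (lambda * h)) * (pr (ev m.+1 t y0) + lambda * h * pr (ev m t y1))
    + (lambda * h) ^+ 2.
Proof.
move=> t0 h0 H0 H1.
have th0 : 0 <= t + h by rewrite addr_ge0// ltW.
have mi k := measurable_increment N t (t + h) k.
have me n y' := measurable_meander_event n y' t0.
apply: (@le_trans _ _ (pr ((ev m.+1 t y0 `&` incr t h 0 `|`
   ev m t y1 `&` incr t h 1) `|` ~` (incr t h 0 `|` incr t h 1)))).
  apply: fine_probability_le.
  - exact: measurable_meander_event.
  - apply: measurableU; first by apply: measurableU; exact: measurableI.
    by apply: measurableC; exact: measurableU.
  - move=> w Ew; have [/= Nth _ _] := Ew.
    have := poisson_nondecreasing N_poisson w t0 (_ : t <= t + h).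
    rewrite lerDl (ltW h0) Nth => /(_ isT) le.
    have [e0|ne0] := eqVneq (N t w) m.+1.
      by left; left; split; [exact: H0|rewrite e0 subnn].
    have [e1|ne1] := eqVneq (N t w) m.
      by left; right; split; [exact: H1|rewrite e1 subSnn].
    right => -[/eqP|e].
      by rewrite subn_eq0 => le'; move: ne0; rewrite eqn_leq le le'.
    by have := subnK le; rewrite e add1n => -[/eqP]; rewrite (negbTE ne1).
apply: (le_trans (fine_probability_setU_le _ _)).
- by apply: measurableU; exact: measurableI.
- by apply: measurableC; exact: measurableU.
apply: lerD; last exact: probability_incr_ge2.
apply: (le_trans (fine_probability_setU_le _ _)); try exact: measurableI.
rewrite !probability_meander_incr// !probability_incr// expr0 expr1.
by rewrite fact0 factS fact0 muln1 !divr1 mul1r; lra.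
Qed.

(** The cases of no jump and of one jump are disjoint, and the remaining case is discarded. *)
Lemma step_ge m t h y y0 y1 : 0 <= t -> 0 < h ->
  (forall w, ev m.+1 t y0 w -> N (t + h) w = m.+1 -> ev m.+1 (t + h) y w) ->
  (forall w, ev m t y1 w -> N (t + h) w = m.+1 -> ev m.+1 (t + h) y w) ->
  expR (- (lambda * h)) * (pr (ev m.+1 t y0) + lambda * h * pr (ev m t y1))
    <= pr (ev m.+1 (t + h) y).
Proof.
move=> t0 h0 H0 H1.
have th0 : 0 <= t + h by rewrite addr_ge0// ltW.
have mi k := measurable_increment N t (t + h) k.
have me n y' := measurable_meander_event n y' t0.
apply: (@le_trans _ _ (pr (ev m.+1 t y0 `&` incr t h 0 `|`
   ev m t y1 `&` incr t h 1))).
  rewrite fine_probability_setU; [|exact: measurableI|exact: measurableI|]; last first.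
    by apply/seteqP; split=> // w [[_ /= ->]] [].
  rewrite !probability_meander_incr// !probability_incr// expr0 expr1.
  by rewrite fact0 factS fact0 muln1 !divr1 mul1r; lra.
apply: fine_probability_le.
- by apply: measurableU; exact: measurableI.
- exact: measurable_meander_event.
have le w : (N t w <= N (t + h) w)%N.
  by apply: (poisson_nondecreasing N_poisson) => //; rewrite lerDl ltW.
move=> w [[Ew /= i]|[Ew /= i]].
  by apply: H0 => //; have [<- _ _] := Ew; rewrite -(subnK (le w)) i.
by apply: H1 => //; have [<- _ _] := Ew; rewrite -(subnK (le w)) i.
Qed.

(** This normalisation absorbs the Poisson factors of a step: the no-jump term then enters the
    recursion with coefficient 1 and the one-jump term with coefficient [h]. *)
Definition meander_weight n t y : R :=
  expR (lambda * t) / lambda ^+ n * pr (ev n t y).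
Local Notation g := meander_weight.

Lemma meander_weight_ge0 n t y : 0 <= g n t y.
Proof.
by rewrite mulr_ge0 ?divr_ge0 ?expR_ge0 ?exprn_ge0 ?fine_ge0// ltW.
Qed.

(** The horizon [T] makes the constant of the quadratic error the same for all cells of a
    subdivision. *)
Lemma meander_weight_step_le m t h y y0 y1 T : 0 <= t -> 0 < h -> t + h <= T ->
  (forall w, ev m.+1 (t + h) y w -> N t w = m.+1 -> ev m.+1 t y0 w) ->
  (forall w, ev m.+1 (t + h) y w -> N t w = m -> ev m t y1 w) ->
  g m.+1 (t + h) y <= g m.+1 t y0 + h * g m t y1 +
     expR (lambda * T) / lambda ^+ m.+1 * lambda ^+ 2 * h ^+ 2.
Proof.
move=> t0 h0 thT H0 H1; rewrite {1}/g.
apply: (@le_trans _ _ (expR (lambda * (t + h)) / lambda ^+ m.+1 *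
  (expR (- (lambda * h)) * (pr (ev m.+1 t y0) + lambda * h * pr (ev m t y1))
    + (lambda * h) ^+ 2))).
  by rewrite ler_wpM2l ?step_le// divr_ge0 ?expR_ge0 ?exprn_ge0// ltW.
rewrite mulrDr; apply: lerD.
  rewrite /g mulrDr expRD expRN exprS le_eqVlt; apply/orP; left; apply/eqP.
  by field; rewrite !gt_eqF ?expR_gt0 ?exprn_gt0.
rewrite exprMn -!mulrA ler_wpM2r//.
  by rewrite !mulr_ge0 ?invr_ge0 ?exprn_ge0// ltW.
by rewrite ler_expR ler_wpM2l// ltW.
Qed.

Lemma meander_weight_step_ge m t h y y0 y1 : 0 <= t -> 0 < h ->
  (forall w, ev m.+1 t y0 w -> N (t + h) w = m.+1 -> ev m.+1 (t + h) y w) ->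
  (forall w, ev m t y1 w -> N (t + h) w = m.+1 -> ev m.+1 (t + h) y w) ->
  g m.+1 t y0 + h * g m t y1 <= g m.+1 (t + h) y.
Proof.
move=> t0 h0 H0 H1; rewrite {3}/g.
apply: (@le_trans _ _ (expR (lambda * (t + h)) / lambda ^+ m.+1 *
  (expR (- (lambda * h)) * (pr (ev m.+1 t y0) + lambda * h * pr (ev m t y1))))).
  rewrite /g mulrDr expRD expRN exprS le_eqVlt; apply/orP; left; apply/eqP.
  by field; rewrite !gt_eqF ?expR_gt0 ?exprn_gt0.
by rewrite ler_wpM2l ?step_ge// divr_ge0 ?expR_ge0 ?exprn_ge0// ltW.
Qed.

Lemma meander_event_saturated n t y : t / 2 <= y -> 0 <= t -> ev n t y = ev n t (t / 2).
Proof.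
move=> ty t0; apply/seteqP; split=> w [Nt S0 Sy]; split=> //.
  by have := S0 _ t0 (lexx _); lra.
by lra.
Qed.

Lemma meander_event_start n y : ev n.+1 0 y = set0.
Proof. by apply/seteqP; split=> // w [/=]; rewrite (poisson_start N_poisson). Qed.

End meander_recursion.

(** * The closed form of the meander probabilities, by induction on the number of jumps *)

Section meander_closed_form.
Context (d : measure_display) (Omega : measurableType d) (R : realType).
Context (P : probability Omega R) (lambda : R) (N : R -> {RV P >-> nat}).
Hypothesis lambda_gt0 : 0 < lambda.
Hypothesis N_poisson : poisson_process lambda N.
Implicit Types (s u t h y : R) (n m k : nat) (E F : set Omega) (w : Omega).

Local Notation ev := (meander_event N).
Local Notation pr E := (fine (P E)).
Local Notation g := (meander_weight lambda N).
Local Notation A := (@two_phase_weight R).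

Let cpath w := poisson_counting_path N_poisson w.

(** Used with [ga], [gb] values of the weight, [Da], [Db] values of its conjectured form, and [X1],
    [X2] equal to [b - a] times the form for one jump fewer at the two ends, as
    [eq_of_small_increments] needs. *)
Lemma increment_sandwich (ga gb Da Db X1 X2 e : R) :
  ga + X1 <= gb + e -> gb <= ga + X2 + e -> X1 <= Db - Da -> Db - Da <= X2 ->
  `|gb - Db - (ga - Da)| <= X2 - X1 + e.
Proof. by move=> *; rewrite ler_norml; apply/andP; split; lra. Qed.

Definition has_closed_form n :=
  forall t y, 0 <= y -> y <= t / 2 -> g n t y = A n (t - y) y.

Lemma closed_form0 : has_closed_form 0.
Proof.
move=> t y y0 yt; have t0 : 0 <= t by lra.
rewrite /two_phase_weight /divided_power /= !expr0 fact0 divr1 mulr1.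
rewrite /meander_weight expr0 divr1.
have -> : ev 0%N t y = [set w | (N (0 + t) w - N 0 w)%N = 0%N].
  apply/seteqP; split=> w.
    by case=> /= Nt _ _; rewrite add0r Nt.
  rewrite /= add0r (poisson_start N_poisson) subn0 => Nt.
  have S s : 0 <= s -> s <= t -> alternating_integral (fun s => N s w) s = s.
    move=> s0 st; have Ns : N s w = 0%N.
      by apply/eqP; rewrite -leqn0 -Nt; exact: (poisson_nondecreasing N_poisson).
    have e : N 0 w = N s w by rewrite Ns (poisson_start N_poisson).
    have := alternating_integral_const (cpath w) (lexx _) s0 e.
    by rewrite Ns expr0 mul1r alternating_integral0 !subr0.
  split=> //; first by move=> s s0 st; rewrite S.
  by rewrite S ?lexx//; lra.
(* The Poisson law is available for nondegenerate intervals only. *)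
have [->|tn0] := eqVneq t 0.
  rewrite addr0 (_ : [set _ | _] = setT).
    by rewrite probability_setT mulr0 expR0 mul1r.
  by apply/seteqP; split=> // w _ /=; rewrite subnn.
rewrite (probability_incr lambda_gt0 N_poisson)// ?expr0 ?fact0 ?divr1 ?mul1r; last first.
  by rewrite lt_neqAle eq_sym tn0.
by rewrite -expRD subrr expR0.
Qed.


Lemma meander_weight_saturated n t y : t / 2 <= y -> 0 <= t ->
  g n t y = g n t (t / 2).
Proof. by move=> ty t0; rewrite /meander_weight meander_event_saturated. Qed.

(** After an odd number of jumps the path is descending. Without a jump in the last [h] units it
    would have down time at least [h], so the weight is of order [h]. *)
Lemma meander_weight_no_down n u : 0 <= u -> odd n -> g n u 0 = 0.
Proof.
case: n => // m u0 nodd.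
have [->|un0] := eqVneq u 0.
  by rewrite /meander_weight (meander_event_start N_poisson) measure0 mulr0.
have up : 0 < u by rewrite lt_neqAle eq_sym un0.
apply/le_anti; rewrite meander_weight_ge0// andbT.
apply/ler_addgt0Pr => e e0; rewrite add0r.
(* [B] bounds the one-jump weight and [C] is the constant of the quadratic error. As [h <= u], the
   total is at most [h * (B + C * u)], hence at most [e] by the choice of [h]. *)
pose B := expR (lambda * u) / lambda ^+ m.
pose C := expR (lambda * u) / lambda ^+ m.+1 * lambda ^+ 2.
have B0 : 0 < B by rewrite divr_gt0 ?expR_gt0 ?exprn_gt0.
have C0 : 0 < C by rewrite !mulr_gt0 ?invr_gt0 ?expR_gt0 ?exprn_gt0.
have Cu : 0 < C * u by rewrite mulr_gt0.
pose h := Num.min (u / 2) (e / (B + C * u)).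
have h0 : 0 < h by rewrite lt_min !divr_gt0// addr_gt0.
have hu : h <= u / 2 by rewrite ge_min lexx.
have he : h * (B + C * u) <= e.
  by rewrite -ler_pdivlMr ?addr_gt0// ge_min lexx orbT.
have t0 : 0 <= u - h by lra.
have := @meander_weight_step_le _ _ _ _ _ _ lambda_gt0 N_poisson
  m (u - h) h 0 (- h) 0 u t0 h0.
rewrite subrK => /(_ (lexx _)) step.
apply: (le_trans (step _ _)).
- move=> w Ew Nt; apply: (path_event_odd (cpath w) t0 (ltW h0) nodd Nt).
  by rewrite subrK addNr.
- move=> w; rewrite -{1}(subrK h u) => Ew Nt; rewrite -Nt.
  exact: path_event_restrict (cpath w) t0 (ltW h0) Ew.
have -> : g m.+1 (u - h) (- h) = 0.
  rewrite /meander_weight (_ : ev _ _ _ = set0) ?measure0 ?mulr0//.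
  apply/seteqP; split=> // w [_ _].
  have := alternating_integral_le (cpath w) (lexx _) t0.
  by rewrite alternating_integral0; lra.
have gB : g m (u - h) 0 <= B.
  rewrite /meander_weight -[leRHS]mulr1 ler_pM ?divr_ge0 ?expR_ge0 ?exprn_ge0 ?fine_ge0// ?(ltW lambda_gt0)//.
    rewrite ler_wpM2r ?invr_ge0 ?exprn_ge0 ?(ltW lambda_gt0)// ler_expR ler_wpM2l ?(ltW lambda_gt0)//; lra.
  rewrite -lee_fin fineK ?fin_num_measure ?probability_le1//;
    exact: (measurable_meander_event N_poisson).
rewrite -/C add0r expr2 mulrA.
have := ler_wpM2l (ltW h0) gB.
have : C * h * h <= C * u * h by rewrite ler_wpM2r ?ler_wpM2l// ltW//; lra.
lra.
Qed.

(** The up time [u] is held fixed and the down time runs from 0 to [y]; at 0 both sides vanish, by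
    [meander_weight_no_down]. *)
Lemma closed_form_odd m : ~~ odd m -> has_closed_form m -> has_closed_form m.+1.
Proof.
move=> mev IH t y y0 yt.
pose u := t - y; have yu : y <= u by rewrite /u; lra.
have tE : t = u + y by rewrite /u; lra.
have u0 : 0 <= u by lra.
have nodd : odd m.+1 by [].
have AE v : A m.+1 u v = divided_power m./2 u * divided_power (uphalf m).+1 v.
  by rewrite /two_phase_weight /= uphalf_half (negbTE mev).
pose C := expR (lambda * (u + y)) / lambda ^+ m.+1 * lambda ^+ 2.
pose f v := g m.+1 (u + v) v - A m.+1 u v.
suff : f y = f 0.
  rewrite {2}/f addr0 meander_weight_no_down// AE divided_powerS0 mulr0 subr0 /f -tE.
  by move/eqP; rewrite subr_eq0 => /eqP.
apply: (@eq_of_small_increments R f (fun v => A m u v + C * v)) => // a b a0 ab bY.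
have h0 : 0 < b - a by rewrite subr_gt0.
have t0 : 0 <= u + a by lra.
have b0 : 0 <= b by lra.
have au2 : a <= (u + a) / 2 by lra.
have ua2u : (u + a) / 2 <= u by lra.
have ua2 : 0 <= (u + a) / 2 by lra.
have ab2 : 2 * (a + (b - a)) <= u + a + (b - a) by lra.
have ubT : u + b <= u + y by lra.
have uab : u + a - b <= u by lra.
have uaa : u + a - (u + a) / 2 = (u + a) / 2 by lra.
have bE : u + a + (b - a) = u + b by ring.
have bE' : a + (b - a) = b by ring.
have up : g m.+1 (u + b) b <= g m.+1 (u + a) a + (b - a) * g m (u + a) b + C * (b - a) ^+ 2.
  have := @meander_weight_step_le _ _ _ _ _ _ lambda_gt0 N_poisson
    m (u + a) (b - a) b a b (u + y) t0 h0.
  rewrite bE; apply => //.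
    move=> w Ew Nt; apply: (path_event_odd (cpath w) t0 (ltW h0) nodd Nt).
    by rewrite bE bE'.
  move=> w; rewrite -bE => Ew Nt; rewrite -Nt.
  exact: path_event_restrict (cpath w) t0 (ltW h0) Ew.
have low : g m.+1 (u + a) a + (b - a) * g m (u + a) a <= g m.+1 (u + b) b.
  have := @meander_weight_step_ge _ _ _ _ _ _ lambda_gt0 N_poisson
    m (u + a) (b - a) b a a t0 h0.
  rewrite bE; apply => w Ew Nt; rewrite -Nt -bE -[X in ev _ _ X]bE';
    exact: path_event_extend (cpath w) t0 (ltW h0) ab2 Ew.
have g1 : g m (u + a) a = A m u a by rewrite IH ?addrK.
(* [b] may exceed half of the elapsed time [u + a], outside the range of the closed form; the weight
   is then saturated. *)
have g2 : g m (u + a) b <= A m u b.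
  have [ba|/ltW ba] := leP b ((u + a) / 2).
    rewrite IH//; apply: two_phase_weight_le => //.
    by rewrite subr_ge0 (le_trans (le_trans ba ua2u))// lerDl.
  by rewrite meander_weight_saturated// IH// uaa; exact: two_phase_weight_le.
have Ch : 0 <= C * (b - a) ^+ 2.
  by rewrite !mulr_ge0 ?invr_ge0 ?expR_ge0 ?exprn_ge0 ?(ltW lambda_gt0)// ltW.
have P0 : 0 <= divided_power m./2 u by exact: divided_power_ge0.
have -> : (b - a) * (A m u b + C * b - (A m u a + C * a)) =
    (b - a) * A m u b - (b - a) * A m u a + C * (b - a) ^+ 2 by ring.
apply: increment_sandwich.
- by rewrite g1 in low; rewrite (le_trans low)// lerDl.
- by rewrite (le_trans up)// lerD2r lerD2l ler_pM2l.
- rewrite !AE -mulrBr /two_phase_weight mulrCA ler_wpM2l//.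
  exact: divided_powerS_ge a0 (ltW ab).
- rewrite !AE -mulrBr /two_phase_weight mulrCA ler_wpM2l//.
  exact: divided_powerS_le a0 (ltW ab).
Qed.

(** Controls the loss caused by [path_event_extend_interior]. For [y >= h] it is a mean value bound
    in the down time; for [y < h] the left-hand side is at most 0. *)
Lemma closed_form_below m t y h : odd m -> has_closed_form m -> 0 <= t -> 0 < h ->
  0 <= y -> y <= t / 2 ->
  A m (t - y) y - h * (divided_power m./2 (t - y) * divided_power m./2 y)
    <= g m t (y - h).
Proof.
move=> modd IH t0 h0 y0 yt.
have u0 : 0 <= t - y by lra.
have up : uphalf m = m./2.+1 by rewrite uphalf_half modd.
have P0 : 0 <= divided_power m./2 (t - y) by exact: divided_power_ge0.
have [yh|hy] := ltP y h.
  apply: le_trans (meander_weight_ge0 N lambda_gt0 _ _ _).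
  have := divided_powerS_le m./2 (lexx 0) y0.
  rewrite divided_powerS0 !subr0 => /(ler_wpM2l P0).
  have : y * (divided_power m./2 (t - y) * divided_power m./2 y) <=
     h * (divided_power m./2 (t - y) * divided_power m./2 y).
    by apply: ler_wpM2r; [rewrite mulr_ge0 ?divided_power_ge0|exact: ltW].
  by rewrite /two_phase_weight up; lra.
rewrite IH; [|lra|lra].
have yh0 : 0 <= y - h by lra.
have yhy : y - h <= y by lra.
apply: (@le_trans _ _ (A m (t - y) (y - h))); last by apply: two_phase_weight_le; lra.
have := ler_wpM2l P0 (divided_powerS_le m./2 yh0 yhy).
by rewrite /two_phase_weight up; lra.
Qed.

(** Starting value for [closed_form_even]. At [t / 2] the down-time bound is implied by
    nonnegativity, so [t] itself can run from 0, where both sides vanish. *)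
Lemma closed_form_diagonal m t : odd m -> has_closed_form m -> 0 <= t ->
  g m.+1 t (t / 2) = A m.+1 (t / 2) (t / 2).
Proof.
move=> modd IH t0.
have nev : ~~ odd m.+1 by rewrite /= modd.
pose k := m./2.
have A_n v : A m.+1 v v = divided_power k.+1 v * divided_power k.+1 v.
  by rewrite /two_phase_weight /= uphalf_half modd.
have A_m v v' : A m v v' = divided_power k v * divided_power k.+1 v'.
  by rewrite /two_phase_weight uphalf_half modd.
pose C := expR (lambda * t) / lambda ^+ m.+1 * lambda ^+ 2.
pose L := divided_power k t * divided_power k t.
pose f v := g m.+1 v (v / 2) - A m.+1 (v / 2) (v / 2).
suff : f t = f 0.
  rewrite /f mul0r /meander_weight (meander_event_start N_poisson) measure0 mulr0.
  rewrite [A m.+1 0 0]A_n divided_powerS0 mulr0 subr0.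
  by move/eqP; rewrite subr_eq0 => /eqP.
(* [C] pays for multiple jumps and [L] for the loss in [closed_form_below]. *)
apply: (@eq_of_small_increments R f (fun v => A m (v / 2) (v / 2) + (L + C) * v)) => //.
move=> a b a0 ab bt.
have h0 : 0 < b - a by rewrite subr_gt0.
have bE : a + (b - a) = b by ring.
have a20 : 0 <= a / 2 by lra.
have ab2 : a / 2 <= b / 2 by lra.
have b20 : 0 <= b / 2 by lra.
have aT : a / 2 <= t by lra.
have aa : a - a / 2 = a / 2 by lra.
have ba2 : (b - a) = 2 * (b / 2 - a / 2) by lra.
have up : g m.+1 b (b / 2) <= g m.+1 a (a / 2) + (b - a) * A m (a / 2) (a / 2) + C * (b - a) ^+ 2.
  have := @meander_weight_step_le _ _ _ _ _ _ lambda_gt0 N_poisson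
    m a (b - a) (b / 2) (b / 2) (b / 2) t a0 h0.
  rewrite bE => /(_ bt).
  rewrite !(@meander_weight_saturated _ a (b / 2))// IH// aa; apply => w Ew Nt;
    rewrite -Nt; rewrite -[X in ev _ X _ w]bE in Ew;
    exact: path_event_restrict (cpath w) a0 (ltW h0) Ew.
have low : g m.+1 a (a / 2) + (b - a) * g m a (a / 2 - (b - a)) <= g m.+1 b (b / 2).
  have := @meander_weight_step_ge _ _ _ _ _ _ lambda_gt0 N_poisson
    m a (b - a) (b / 2) (b / 2) (a / 2 - (b - a)) a0 h0.
  rewrite bE (@meander_weight_saturated _ a (b / 2))//; apply => w Ew Nt.
    rewrite -bE; apply: (path_event_even (cpath w) a0 (ltW h0) nev); rewrite bE //.
  rewrite -Nt -[X in ev _ X _]bE -[X in N X]bE.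
  apply: (path_event_extend_interior (n := m) (cpath w) a0 (ltW h0)).
  by rewrite min_r.
have gl := closed_form_below modd IH a0 h0 a20 (lexx _).
rewrite aa in gl.
have Lk : divided_power k (a / 2) * divided_power k (a / 2) <= L.
  by apply: ler_pM; rewrite ?divided_power_ge0 ?divided_power_le.
have Ch : 0 <= C * (b - a) ^+ 2.
  by rewrite !mulr_ge0 ?invr_ge0 ?expR_ge0 ?exprn_ge0 ?(ltW lambda_gt0)// ltW.
have Lh : 0 <= L * (b - a) ^+ 2.
  by rewrite !mulr_ge0 ?divided_power_ge0 ?exprn_ge0 // ltW.
have -> : (b - a) * (A m (b / 2) (b / 2) + (L + C) * b - (A m (a / 2) (a / 2) + (L + C) * a)) =
    (b - a) * A m (b / 2) (b / 2) - (b - a) * A m (a / 2) (a / 2)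
    + (C * (b - a) ^+ 2 + L * (b - a) ^+ 2) by ring.
have D1 := divided_powerS_ge k a20 ab2.
have D2 := divided_powerS_le k a20 ab2.
have Fa0 := divided_power_ge0 k.+1 a20.
have Fab := divided_power_le k.+1 a20 ab2.
have fb0 := divided_power_ge0 k b20.
apply: increment_sandwich.
- apply: le_trans (lerD low (lexx _)).
  rewrite -addrA lerD2l (le_trans _ (lerD (ler_wpM2l (ltW h0) gl) (lexx _)))//.
  rewrite mulrBr -addrA lerDl addrCA addr_ge0// addrC subr_ge0.
  have -> : L * (b - a) ^+ 2 = (b - a) * ((b - a) * L) by ring.
  by do 2!(apply: ler_wpM2l; first exact: ltW).
- apply: (le_trans up); apply: lerD; last by rewrite lerDl.
  rewrite lerD2l ler_pM2l//.
  exact: two_phase_weight_le.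
(* [Fb ^+ 2 - Fa ^+ 2] lies between [2 * Fa * (Fb - Fa)] and [2 * Fb * (Fb - Fa)]; the factor 2
   matches [b - a = 2 * (b / 2 - a / 2)]. *)
- rewrite !A_n !A_m ba2; move: D1 Fa0 Fab; clear.
  set Fa := divided_power k.+1 (a / 2); set Fb := divided_power k.+1 (b / 2).
  set fa := divided_power k (a / 2); set h := b / 2 - a / 2.
  move=> D1 Fa0 Fab; have D : 0 <= Fb - Fa by rewrite subr_ge0.
  have := ler_wpM2r Fa0 D1; have := mulr_ge0 D D; clearbody Fa Fb fa h; nra.
- rewrite !A_n !A_m ba2; move: D2 Fa0 Fab; clear.
  set Fa := divided_power k.+1 (a / 2); set Fb := divided_power k.+1 (b / 2).
  set fb := divided_power k (b / 2); set h := b / 2 - a / 2.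
  move=> D2 Fa0 Fab; have D : 0 <= Fb - Fa by rewrite subr_ge0.
  have Fb0 : 0 <= Fb by rewrite (le_trans Fa0).
  have := ler_wpM2r Fb0 D2; have := mulr_ge0 D D; clearbody Fa Fb fb h; nra.
Qed.

(** The down-time bound [y] is held fixed and the up time runs from [y], on the diagonal, to
    [t - y]. *)
Lemma closed_form_even m : odd m -> has_closed_form m -> has_closed_form m.+1.
Proof.
move=> modd IH t y y0 yt.
have nev : ~~ odd m.+1 by rewrite /= modd.
pose U := t - y; have yU : y <= U by rewrite /U; lra.
have tE : t = U + y by rewrite /U; lra.
have U0 : 0 <= U by lra.
pose k := m./2.
have A_n v : A m.+1 v y = divided_power k.+1 v * divided_power k.+1 y.
  by rewrite /two_phase_weight /= uphalf_half modd.
have A_m v v' : A m v v' = divided_power k v * divided_power k.+1 v'.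
  by rewrite /two_phase_weight uphalf_half modd.
pose C := expR (lambda * (U + y)) / lambda ^+ m.+1 * lambda ^+ 2.
pose L := divided_power k U * divided_power k y.
pose f v := g m.+1 (v + y) y - A m.+1 v y.
suff : f U = f y.
  have := @closed_form_diagonal m (y + y) modd IH.
  rewrite (_ : (y + y) / 2 = y); last by lra.
  rewrite /f -tE => ->; last by lra.
  by rewrite subrr => /eqP; rewrite subr_eq0 => /eqP.
apply: (@eq_of_small_increments R f (fun v => A m v y + (L + C) * v)) => //.
move=> a b ya ab bU.
have h0 : 0 < b - a by rewrite subr_gt0.
have t0 : 0 <= a + y by lra.
have a0 : 0 <= a by lra.
have ya2 : y <= (a + y) / 2 by lra.
have byT : b + y <= U + y by lra.
have bE : a + y + (b - a) = b + y by ring.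
have up : g m.+1 (b + y) y <= g m.+1 (a + y) y + (b - a) * g m (a + y) y + C * (b - a) ^+ 2.
  have := @meander_weight_step_le _ _ _ _ _ _ lambda_gt0 N_poisson
    m (a + y) (b - a) y y y (U + y) t0 h0.
  rewrite bE; apply => //.
    by move=> w; rewrite -bE => Ew Nt; rewrite -Nt;
      exact: path_event_restrict (cpath w) t0 (ltW h0) Ew.
  by move=> w; rewrite -bE => Ew Nt; rewrite -Nt;
      exact: path_event_restrict (cpath w) t0 (ltW h0) Ew.
have low : g m.+1 (a + y) y + (b - a) * g m (a + y) (y - (b - a)) <= g m.+1 (b + y) y.
  have := @meander_weight_step_ge _ _ _ _ _ _ lambda_gt0 N_poisson
    m (a + y) (b - a) y y (y - (b - a)) t0 h0.
  rewrite bE; apply => w Ew Nt.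
    by rewrite -bE; apply: (path_event_even (cpath w) t0 (ltW h0) nev); rewrite ?bE.
  rewrite -Nt -bE.
  apply: (path_event_extend_interior (n := m) (cpath w) t0 (ltW h0)).
  by rewrite min_l.
rewrite IH// addrK in up.
have gl := closed_form_below modd IH t0 h0 y0 ya2.
rewrite addrK in gl.
have Lk : divided_power k a * divided_power k y <= L.
  by apply: ler_pM; rewrite ?divided_power_ge0 ?divided_power_le// (le_trans _ bU)// ltW.
have Ch : 0 <= C * (b - a) ^+ 2.
  by rewrite !mulr_ge0 ?invr_ge0 ?expR_ge0 ?exprn_ge0 ?(ltW lambda_gt0)// ltW.
have Lh : 0 <= L * (b - a) ^+ 2.
  by rewrite !mulr_ge0 ?divided_power_ge0 ?exprn_ge0 // ltW.
have -> : (b - a) * (A m b y + (L + C) * b - (A m a y + (L + C) * a)) =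
    (b - a) * A m b y - (b - a) * A m a y
    + (C * (b - a) ^+ 2 + L * (b - a) ^+ 2) by ring.
have Fy0 := divided_power_ge0 k.+1 y0.
apply: increment_sandwich.
- apply: le_trans (lerD low (lexx _)).
  rewrite -addrA lerD2l (le_trans _ (lerD (ler_wpM2l (ltW h0) gl) (lexx _)))//.
  rewrite mulrBr -addrA lerDl addrCA addr_ge0// addrC subr_ge0.
  have -> : L * (b - a) ^+ 2 = (b - a) * ((b - a) * L) by ring.
  by do 2!(apply: ler_wpM2l; first exact: ltW).
- apply: (le_trans up); apply: lerD; last by rewrite lerDl.
  rewrite lerD2l ler_pM2l//.
  by apply: two_phase_weight_le => //; exact: ltW.
- rewrite !A_n !A_m -mulrBl mulrA ler_wpM2r//; exact: divided_powerS_ge a0 (ltW ab).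
- rewrite !A_n !A_m -mulrBl mulrA ler_wpM2r//; exact: divided_powerS_le a0 (ltW ab).
Qed.

Lemma meander_closed_form n : has_closed_form n.
Proof.
elim: n => [|n IH]; first exact: closed_form0.
have [nodd|nev] := boolP (odd n); first exact: closed_form_even.
exact: closed_form_odd.
Qed.

Lemma meander_event_probability n t y : 0 <= y -> y <= t / 2 ->
  P (ev n t y) = (lambda ^+ n * expR (- (lambda * t)) * A n (t - y) y)%:E.
Proof.
move=> y0 yt; rewrite -(meander_closed_form n y0 yt) /meander_weight expRN.
rewrite -[LHS]fineK ?fin_num_measure//; last first.
  by apply: (measurable_meander_event N_poisson); lra.
by congr EFin; field; rewrite !gt_eqF ?expR_gt0 ?exprn_gt0.
Qed.

End meander_closed_form.

(** * Finite measures on the line, densities and restricted laws *)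

Section measures_on_the_line.
Context (R : realType).

(* Rays generate the Borel sets and are closed under intersection. *)
Lemma finite_measure_eq_on_rays (m1 m2 : {measure set R -> \bar R}) :
  (forall x, m1 `[x, +oo[%classic = m2 `[x, +oo[%classic) ->
  (forall x, (m1 `[x, +oo[%classic < +oo)%E) ->
  forall A, measurable A -> m1 A = m2 A.
Proof.
move=> m12 m1oo A mA.
pose g (n : nat) := `[- n%:R : R, +oo[%classic.
have IG : setI_closed (@RGenCInfty.G R).
  move=> _ _ [x ->] [y ->]; exists (Num.max x y).
  apply/seteqP; split=> z; rewrite /= !in_itv/= !andbT ge_max; first by case=> -> ->.
  by move=> /andP[].
have gG n : @RGenCInfty.G R (g n) by exists (- n%:R).
have g_cover : \bigcup_n g n = setT.
  apply/seteqP; split=> // x _; exists (Num.truncn `|x|).+1 => //=.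
  rewrite /g /= in_itv/= andbT lerNl; apply: (le_trans (ler_norm _)); rewrite normrN.
  exact/ltW/truncnS_gt.
have m12G B : @RGenCInfty.G R B -> m1 B = m2 B by move=> [x ->]; exact: m12.
have m1g n : (m1 (g n) < +oo)%E by exact: m1oo.
refine (@measure_unique _ _ _ (@RGenCInfty.G R) g _ IG gG g_cover m1 m2 m12G m1g A mA).
exact: RGenCInfty.measurableE.
Qed.

(** The two proofs are arguments so that the measure structure can be attached to this term;
    likewise for [restricted_law]. *)
Definition density_measure (f : R -> R) (mf : measurable_fun setT f)
  (f0 : forall x, 0 <= f x) (A : set R) : \bar R :=
  (\int[lebesgue_measure]_(x in A) (f x)%:E)%E.

Section density_measure.
Context (f : R -> R) (mf : measurable_fun setT f) (f0 : forall x, 0 <= f x).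
Local Notation nu := (density_measure mf f0).

Let nu0 : nu set0 = 0%E. Proof. exact: integral_set0. Qed.

Let nu_ge0 A : (0 <= nu A)%E.
Proof. by apply: integral_ge0 => x _; rewrite lee_fin. Qed.

Let nu_sigma_additive : semi_sigma_additive nu.
Proof.
move=> /= A mA tA mUA; rewrite /density_measure ge0_integral_bigcup//.
- by apply: is_cvg_ereal_nneg_natsum_cond => n _ _; exact: nu_ge0.
- by apply/measurable_EFinP; exact: measurable_funTS.
- by move=> x _; rewrite lee_fin.
Qed.

HB.instance Definition _ := isMeasure.Build _ _ _ nu nu0 nu_ge0 nu_sigma_additive.

End density_measure.

Section restricted_law.
Context (d : measure_display) (T : measurableType d).

Definition restricted_law (P : {measure set T -> \bar R}) (G : set T) (X : T -> R)
  (mG : measurable G) (mX : measurable_fun setT X) (A : set R) : \bar R :=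
  P (G `&` X @^-1` A).

Context (P : {measure set T -> \bar R}) (G : set T) (X : T -> R).
Context (mG : measurable G) (mX : measurable_fun setT X).
Local Notation mu := (restricted_law P mG mX).

Let mXA A : measurable A -> measurable (G `&` X @^-1` A).
Proof. by move=> mA; apply: measurableI => //; rewrite -[X @^-1` _]setTI; exact: mX. Qed.

Let mu0 : mu set0 = 0%E.
Proof. by rewrite /restricted_law preimage_set0 setI0 measure0. Qed.

Let mu_ge0 A : (0 <= mu A)%E. Proof. exact: measure_ge0. Qed.

Let mu_sigma_additive : semi_sigma_additive mu.
Proof.
move=> F mF tF mUF; rewrite /restricted_law preimage_bigcup setI_bigcupr.
apply: measure_semi_sigma_additive.
- by move=> n; exact: mXA.
- apply/trivIsetP => /= i j _ _ ij; rewrite setIACA -preimage_setI.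
  by move/trivIsetP : tF => /(_ _ _ _ _ ij) ->//; rewrite preimage_set0 setI0.
- by rewrite -setI_bigcupr -preimage_bigcup; exact: mXA.
Qed.

HB.instance Definition _ := isMeasure.Build _ _ _ mu mu0 mu_ge0 mu_sigma_additive.

End restricted_law.

Lemma integral_horner_deriv (p : {poly R}) (a b : R) : a <= b ->
  (\int[lebesgue_measure]_(x in `[a, b]) (p^`().[x])%:E = (p.[b] - p.[a])%:E)%E.
Proof.
rewrite le_eqVlt => /predU1P[->|ab].
  by rewrite set_itv1 integral_set1 subrr.
rewrite (@continuous_FTC2 _ _ (horner p)) ?EFinB//.
- by apply/continuous_subspaceT => x; exact: continuous_horner.
- split=> [x _| |]; first exact: derivable_horner.
  + by apply: cvg_at_right_filter; exact: continuous_horner.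
  + by apply: cvg_at_left_filter; exact: continuous_horner.
- by move=> x _; rewrite derivE.
Qed.

End measures_on_the_line.

(** * From the unit-speed process to the telegraph process *)

Section telegraph_paths.
Context (d : measure_display) (Omega : measurableType d) (R : realType).
Context (P : probability Omega R) (lambda c : R).
Context (V0 : {RV P >-> R}) (N : R -> {RV P >-> nat}).
Hypothesis N_poisson : poisson_process lambda N.
Implicit Types (s u t h y : R) (n m k : nat) (w : Omega).

Local Notation S w := (alternating_integral (fun s => N s w)).

Lemma telegraphE t w : telegraph V0 N t w = V0 w * S w t.
Proof.
rewrite /telegraph /alternating_integral /velocity RintegralZl//.
exact: integrable_alternating (poisson_counting_path N_poisson w) (lexx _).
Qed.

Lemma stays_nonnegativeP t w : stays_nonnegative V0 N t w <->
  forall s, 0 <= s -> s <= t -> 0 <= telegraph V0 N s w.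
Proof.
split=> [H s s0 st|H].
  rewrite -lee_fin; apply: (le_trans H); apply: ereal_inf_lbound.
  by exists s => //=; rewrite in_itv/= s0.
apply: le_ereal_inf_tmp => _ [s /= + <-]; rewrite in_itv/= => /andP[s0 st].
by rewrite lee_fin H.
Qed.

(* By right continuity there is no jump immediately after time 0. *)
Lemma alternating_integral_gt0 t w : 0 < t ->
  exists s, [/\ 0 <= s, s <= t & 0 < S w s].
Proof.
move=> t0.
have H := poisson_right_continuous N_poisson (w := w) (lexx 0).
rewrite (poisson_start N_poisson) in H.
have : \forall u \near (0 : R)^'+, N u w = 0%N.
  by apply: (H [set 0%N]); exact: discrete_set1.
move=> [e /= e0 He].
pose s := Num.min t (e / 2).
have s0 : 0 < s by rewrite lt_min t0 divr_gt0.
have se : s < e.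
  by rewrite (@le_lt_trans _ _ (e / 2))// ?ge_min ?lexx ?orbT// ltr_pdivrMr// ltr_pMr// ltr1n.
have Ns : N s w = 0%N.
  by apply: He => //=; rewrite sub0r normrN gtr0_norm.
exists s; split; [exact: ltW|by rewrite ge_min lexx|].
have N0s : N 0 w = N s w by rewrite Ns (poisson_start N_poisson).
have := alternating_integral_const (poisson_counting_path N_poisson w) (lexx _) (ltW s0) N0s.
by rewrite alternating_integral0 Ns expr0 mul1r !subr0 => ->.
Qed.

Lemma measurable_sign s : measurable_fun setT (fun w => (-1) ^+ N s w : R).
Proof.
move=> _ B mB; rewrite setTI.
exact: (measurable_funPTI (N s) (I : measurable [set n | B ((-1) ^+ n)])).
Qed.

(** Pointwise limit of dyadic Riemann sums; for each [w] the error is at most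
    [2 * t * N t w / 2 ^ M]. *)
Lemma measurable_alternating_integral t : 0 <= t ->
  measurable_fun setT (fun w => S w t).
Proof.
move=> t0.
apply: (@measurable_fun_cvg _ _ _ _ (fun M w => \sum_(i < 2 ^ M)
  (dyadic t M i.+1 - dyadic t M i) * (-1) ^+ N (dyadic t M i) w)).
  move=> M; apply: measurable_sum => i; apply: measurable_funM => //.
  exact: measurable_sign.
move=> w _.
have pP := poisson_counting_path N_poisson w.
apply/cvgrPdist_le => e e0.
pose K := 2 * t * (N t w)%:R.
have K0 : 0 <= K by rewrite !mulr_ge0.
near=> M.
have := @riemann_sum_error _ _ (t / (2 ^ M)%:R) (dyadic t M) pP _ (dyadic0 t M) _ _ (2 ^ M)%N.
rewrite dyadic_last//; move/(_ _ _ _)/le_trans; apply.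
- by rewrite divr_ge0.
- by move=> i; rewrite dyadic_homo.
- by move=> i; exact: dyadic_step.
rewrite mulrA mulrAC -/K ler_pdivrMr ?ltr0n ?expn_gt0// mulrC -ler_pdivrMr//.
apply: (@le_trans _ _ M%:R); last by rewrite ler_nat ltnW// ltn_expl.
by near: M; exact: nbhs_infty_ger.
Unshelve. all: by end_near. Qed.

Lemma measurable_telegraph t : 0 <= t -> measurable_fun setT (telegraph V0 N t).
Proof.
move=> t0; rewrite (_ : telegraph _ _ _ = (fun w => V0 w * S w t)); last first.
  by apply/funext => w; rewrite telegraphE.
by apply: measurable_funM => //; exact: measurable_alternating_integral.
Qed.

(** A negative initial velocity takes the path below 0 as soon as [S] is positive, a positive one
    only rescales [S], and a zero one, possible on a null set, gives the zero path. *)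
Lemma stays_nonnegativeE t n : 0 < t ->
  stays_nonnegative V0 N t `&` [set w | N t w = n] =
  (V0 @^-1` `]0, +oo[%classic `&` meander_event N n t (t / 2)) `|`
  (V0 @^-1` [set 0] `&` [set w | N t w = n]).
Proof.
move=> t0; apply/seteqP; split=> [w [/stays_nonnegativeP H /= Nt]|].
  have [V|V|V] := ltgtP (V0 w) 0.
  - have [s [s0 st Ss]] := alternating_integral_gt0 w t0.
    by have := H s s0 st; rewrite telegraphE leNgt nmulr_rlt0// Ss.
  - left; split; first by rewrite /= in_itv/= V.
    have S0 s : 0 <= s -> s <= t -> 0 <= S w s.
      by move=> s0 st; have := H s s0 st; rewrite telegraphE pmulr_rge0.
    split=> //; have := S0 t (ltW t0) (lexx _); lra.
  - by right.
move=> w [[]|[/= V Nt]].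
  rewrite /= in_itv/= andbT => V [Nt S0 _]; split=> //.
  apply/stays_nonnegativeP => s s0 st; rewrite telegraphE mulr_ge0// ?(ltW V)//.
  exact: S0.
split=> //; apply/stays_nonnegativeP => s s0 st.
by rewrite telegraphE V mul0r.
Qed.

(** When [V0 = c], being at least [x] at time [t] means having down time at most
    [(t - x / c) / 2]. *)
Lemma meander_event_telegraph_ge t n x : 0 < c -> 0 < t ->
  (V0 @^-1` [set c] `&` meander_event N n t (t / 2)) `&`
    telegraph V0 N t @^-1` `[x, +oo[%classic =
  V0 @^-1` [set c] `&` (meander_event N n t (Num.min (t / 2) ((t - x / c) / 2))).
Proof.
move=> c0 t0; apply/seteqP; split=> w.
  move=> [[/= V [Nt S0 St]]]; rewrite in_itv/= andbT telegraphE V => xS.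
  split=> //; split=> //.
  have xc : x / c <= S w t by rewrite ler_pdivrMr// mulrC.
  by rewrite /Num.min; case: ifP => _; lra.
move=> [/= V [Nt S0 St]]; rewrite in_itv/= andbT telegraphE V.
have [m1 m2] : Num.min (t / 2) ((t - x / c) / 2) <= t / 2 /\
  Num.min (t / 2) ((t - x / c) / 2) <= (t - x / c) / 2.
  by rewrite !ge_min !lexx orbT.
split; first by split=> //; split=> //; lra.
by rewrite mulrC -ler_pdivrMr//; lra.
Qed.

End telegraph_paths.

(** * The tail of the meander as a polynomial, and its derivative *)

Section tail_polynomial.
Context (R : realType).
Implicit Types (X x : R) (n k : nat).

(** With [X = c * t] and [0 <= x <= X], its value at [x] is the conditional probability that the
    meander ends at or above [x]. *)
Definition tail_poly X n : {poly R} :=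
  X ^- n *: (('X + X%:P) ^+ n./2 * (X%:P - 'X) ^+ uphalf n).

Lemma tail_polyE X n x :
  (tail_poly X n).[x] = X ^- n * ((x + X) ^+ n./2 * (X - x) ^+ uphalf n).
Proof. by rewrite /tail_poly !hornerE. Qed.

Lemma tail_poly_last X n : (tail_poly X n.+1).[X] = 0.
Proof. by rewrite tail_polyE subrr /= expr0n !mulr0. Qed.

Lemma tail_poly_deriv_even X k x :
  - (tail_poly X (2 * k.+1))^`().[x] =
  (2 * k.+1)%:R * x * ((X ^+ 2 - x ^+ 2) ^+ k / X ^+ (2 * k.+1)).
Proof.
rewrite /tail_poly mul2n uphalf_double doubleK.
rewrite derivZ derivM !deriv_exp !derivD !derivN !derivX !derivC.
rewrite !hornerE !hornerMn /= !hornerE /=.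
rewrite (_ : X ^+ 2 - x ^+ 2 = (x + X) * (X - x)); last by ring.
rewrite (exprMn k (x + X) (X - x)) -(mul2n k.+1) natrM (exprS (x + X) k) (exprS (X - x) k).
by move: ((x + X) ^+ k) ((X - x) ^+ k) (X ^- (2 * k.+1)) => p r Y; ring.
Qed.

(** The product rule leaves the factor [k.+1 - k * (X - x) / (X + x)], that is
    [(X + (2 * k + 1) * x) / (X + x)]. *)
Lemma tail_poly_deriv_odd X k x : X + x != 0 ->
  - (tail_poly X (2 * k + 1))^`().[x] =
  (X + (2 * k + 1)%:R * x) / X ^+ (2 * k + 1) * ((X ^+ 2 - x ^+ 2) ^+ k / (X + x)).
Proof.
move=> Xx; rewrite /tail_poly addn1 mul2n /= uphalf_double doubleK.
rewrite derivZ derivM !deriv_exp !derivD !derivN !derivX !derivC.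
rewrite !hornerE !hornerMn /= !hornerE /=.
rewrite (_ : X ^+ 2 - x ^+ 2 = (X + x) * (X - x)); last by ring.
rewrite (exprMn k (X + x) (X - x)) (addrC x X).
rewrite (_ : k.*2.+1%:R = 2 * k%:R + 1 :> R); last by rewrite -natr1 -mul2n natrM.
move: (X ^- k.*2.+1) => Y; case: k => [|k] /=.
  by rewrite !expr0 expr1; field; rewrite Xx.
rewrite (exprS (X - x) k.+1) (exprS (X - x) k) (exprS (X + x) k).
by move: ((X + x) ^+ k) ((X - x) ^+ k) => p r; field; rewrite Xx.
Qed.

End tail_polynomial.

(** * The conditional law of the meander *)

Section meander_law_formula.
Context (d : measure_display) (Omega : measurableType d) (R : realType).
Context (P : probability Omega R) (lambda c t : R).
Context (V0 : {RV P >-> R}) (N : R -> {RV P >-> nat}).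
Hypothesis lambda_gt0 : 0 < lambda.
Hypothesis c_gt0 : 0 < c.
Hypothesis t_gt0 : 0 < t.
Hypothesis N_poisson : poisson_process lambda N.
Hypothesis V0_uniform : uniform_sign c V0.
Hypothesis V0_N_independent : independent_of_process V0 N.
Implicit Types (n k : nat) (A : set R) (w : Omega) (x y : R).

Local Notation T := (telegraph V0 N t).
Local Notation ev := (meander_event N).
Local Notation G n := (V0 @^-1` [set c] `&` ev n t (t / 2)).
Local Notation B n := (stays_nonnegative V0 N t `&` [set w | N t w = n]).

Let mV (D : set R) : measurable D -> measurable (V0 @^-1` D).
Proof. exact: measurable_funPTI. Qed.

Let mG n : measurable (G n).
Proof.
apply: measurableI; first exact: mV.
by apply: (measurable_meander_event N_poisson); exact: ltW.
Qed.

Let mT : measurable_fun setT T.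
Proof. by apply: (measurable_telegraph V0 N_poisson); exact: ltW. Qed.

Let mTA A : measurable A -> measurable (T @^-1` A).
Proof. by move=> mA; rewrite -[T @^-1` _]setTI; exact: mT. Qed.

Let mB n : measurable (B n).
Proof.
rewrite (stays_nonnegativeE V0 N_poisson n t_gt0).
apply: measurableU; apply: measurableI; try exact: mV.
  by apply: (measurable_meander_event N_poisson); exact: ltW.
exact: measurable_level.
Qed.

Let V0_null : P (~` (V0 @^-1` [set c] `|` V0 @^-1` [set - c])) = 0%E.
Proof.
have [Pc PNc] := V0_uniform.
rewrite probability_setC; last by apply: measurableU; exact: mV.
suff -> : P (V0 @^-1` [set c] `|` V0 @^-1` [set - c]) = 1%E by rewrite subee.
rewrite measureU; [|exact: mV|exact: mV|]; last first.
  apply/seteqP; split=> // w [/= -> /eqP]; rewrite -addr_eq0 => /eqP c2.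
  by move: c_gt0; lra.
transitivity ((2^-1)%:E + (2^-1)%:E : \bar R)%E.
  by congr (_ + _)%E; [exact: Pc|exact: PNc].
by rewrite -EFinD; congr EFin; lra.
Qed.

(** Almost surely [V0] is [c] or [- c], and [- c] is incompatible with staying nonnegative. *)
Lemma probability_conditioned n A : measurable A ->
  P (T @^-1` A `&` B n) = P (G n `&` T @^-1` A).
Proof.
move=> mA; set C := V0 @^-1` [set c] `|` V0 @^-1` [set - c].
have mC : measurable C by apply: measurableU; exact: mV.
have mE : measurable (T @^-1` A `&` B n) by apply: measurableI; [exact: mTA|exact: mB].
have D0 : P ((T @^-1` A `&` B n) `\` C) = 0%E.
  apply: (subset_measure0 _ _ _ V0_null); [exact: measurableD|exact: measurableC|].
  by move=> w [].
rewrite (measureDI P mE mC); set z := (X in (X + _)%E); have -> : z = 0%E := D0.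
rewrite add0e; congr (P _); rewrite (stays_nonnegativeE V0 N_poisson n t_gt0).
apply/seteqP; split=> [w [[TA H] [/= V|/= V]]|w [[/= V E] TA]].
- case: H => [[_ E]|[/= V' _]]; first by [].
  by move: c_gt0; rewrite -V V' ltxx.
- case: H => [[/= + _]|[/= V' _]]; first by rewrite in_itv/= andbT V oppr_gt0 ltNge ltW.
  by move/eqP: V'; rewrite V oppr_eq0 gt_eqF.
- split; last by left.
  by split=> //; left; split=> //; rewrite /= in_itv/= V c_gt0.
Qed.

Let weight n := 2^-1 * (lambda ^+ n * expR (- (lambda * t))).

Lemma probability_start_and_event n y : 0 <= y -> y <= t / 2 ->
  P (V0 @^-1` [set c] `&` ev n t y) =
  (weight n * two_phase_weight n (t - y) y)%:E.
Proof.
move=> y0 yt.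
have [sE _] := meander_event_independent N_poisson n y (ltW t_gt0).
rewrite V0_N_independent// (meander_event_probability lambda_gt0 N_poisson)//.
by rewrite [P _]V0_uniform.1 -EFinM mulrA.
Qed.

Let Z n := weight n * two_phase_weight n (t / 2) (t / 2).

Let Z_gt0 n : 0 < Z n.
Proof.
by rewrite !mulr_gt0 ?invr_gt0 ?divided_power_gt0 ?expR_gt0 ?exprn_gt0 ?divr_gt0.
Qed.

Let PG n : P (G n) = (Z n)%:E.
Proof.
rewrite probability_start_and_event ?lexx ?divr_ge0 ?(ltW t_gt0)//.
by congr (_ * two_phase_weight _ _ _)%:E; lra.
Qed.

Let PB n : P (B n) = (Z n)%:E.
Proof.
rewrite -PG -[B n]setTI -(preimage_setT T) probability_conditioned//.
by rewrite preimage_setT setIT.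
Qed.

(** The weight is homogeneous in each of its two arguments, and these are [t / 2] times
    [(c * t + x) / (c * t)] and [(c * t - x) / (c * t)]. *)
Lemma two_phase_weight_tail n x :
  two_phase_weight n ((t + x / c) / 2) ((t - x / c) / 2) =
  two_phase_weight n (t / 2) (t / 2) * (tail_poly (c * t) n).[x].
Proof.
rewrite /two_phase_weight tail_polyE /divided_power.
have nE : n = (n./2 + uphalf n)%N by rewrite uphalf_half addnC -addnA addnn odd_double_half.
rewrite [X in _ ^- X]nE exprD.
rewrite (_ : (t + x / c) / 2 = (x + c * t) / (2 * c)); last by field; rewrite gt_eqF.
rewrite (_ : (t - x / c) / 2 = (c * t - x) / (2 * c)); last by field; rewrite gt_eqF.
rewrite !exprMn !exprVn !exprMn.
by field; rewrite !(expf_neq0, gt_eqF, pnatr_eq0)// -?lt0n ?fact_gt0.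
Qed.

Lemma probability_ray n x : P (G n.+1 `&` T @^-1` `[x, +oo[%classic) =
  (if x < c * t then Z n.+1 * (tail_poly (c * t) n.+1).[Num.max x 0] else 0)%:E.
Proof.
rewrite (meander_event_telegraph_ge V0 N_poisson n.+1 x c_gt0 t_gt0).
set y := Num.min _ _.
have [xc|cx] := ltP x (c * t).
  have xct : x / c < t by rewrite ltr_pdivrMr// mulrC.
  have -> : y = (t - Num.max x 0 / c) / 2.
    (* A ray starting below 0 imposes nothing on a nonnegative path, whence [Num.max x 0]. *)
    rewrite /y; have [x0|x0] := leP x 0.
      rewrite mul0r subr0; apply: min_l.
      have : x / c <= 0 by rewrite pmulr_lle0 ?invr_gt0.
      lra.
    apply: min_r; have : 0 < x / c by rewrite divr_gt0.
    lra.
  have [m0 mc] : 0 <= Num.max x 0 / c /\ Num.max x 0 / c <= t.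
    split; first by rewrite divr_ge0 ?le_max ?lexx ?orbT ?(ltW c_gt0).
    rewrite ler_pdivrMr// ge_max (mulrC t) (ltW xc)/=.
    by rewrite mulr_ge0 ?(ltW c_gt0) ?(ltW t_gt0).
  rewrite probability_start_and_event; [|lra|lra].
  rewrite /Z -mulrA -two_phase_weight_tail.
  by congr (_ * two_phase_weight _ _ _)%:E; lra.
have tx : t <= x / c by rewrite ler_pdivlMr// mulrC.
(* Beyond [c * t] the event is empty; at [c * t] the down time must be 0, and with at least one jump
   that has weight 0, so there is no atom. *)
have [y0|y0] := ltP y 0.
  rewrite (_ : _ `&` _ = set0) ?measure0//.
  apply/seteqP; split=> // w [_ [_ _]].
  have := alternating_integral_le (poisson_counting_path N_poisson w) (lexx 0) (ltW t_gt0).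
  by rewrite alternating_integral0; lra.
have yE : y = 0.
  apply/le_anti; rewrite y0 andbT /y ge_min; apply/orP; right; lra.
rewrite yE probability_start_and_event; [|by []|by rewrite divr_ge0 ?(ltW t_gt0)].
by rewrite /two_phase_weight divided_powerS0 !mulr0.
Qed.

(** The unnormalised law and [Z n.+1] times the density define measures that agree on rays, by
    integrating the derivative of the tail polynomial. *)
Lemma meander_law_density n (f : R -> R) :
  (forall x, 0 <= x -> x < c * t -> f x = - (tail_poly (c * t) n.+1)^`().[x]) ->
  (forall x, 0 <= x -> x < c * t -> 0 <= f x) ->
  forall A, measurable A -> meander_law V0 N t n.+1 A =
    (\int[lebesgue_measure]_(x in A) (f x * \1_`[0, c * t[ x)%:E)%E.
Proof.
move=> fE f_ge0 A mA.
pose q : {poly R} := - Z n.+1 *: tail_poly (c * t) n.+1.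
(* As [f] is prescribed only on the interval, measurability is obtained from the polynomial. *)
pose g x := q^`().[x] * \1_`[0, c * t[ x.
have gE x : g x = Z n.+1 * (f x * \1_`[0, c * t[ x).
  rewrite /g indicE; case: (boolP (x \in _)) => [|_]; last by rewrite !mulr0.
  rewrite inE/= in_itv/= => /andP[x0 xc].
  by rewrite fE// /q derivZ hornerZ !mulr1 mulNr mulrN.
have mg : measurable_fun setT g.
  apply: measurable_funM; last exact: measurable_indic.
  by apply: continuous_measurable_fun; exact: continuous_horner.
have fI_ge0 x : 0 <= f x * \1_`[0, c * t[ x.
  rewrite indicE; case: (boolP (x \in _)) => [|_]; last by rewrite mulr0.
  by rewrite inE/= in_itv/= => /andP[x0 xc]; rewrite mulr1 f_ge0.
have g_ge0 x : 0 <= g x by rewrite gE mulr_ge0// ltW.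
have g_ray x : (\int[lebesgue_measure]_(y in `[x, +oo[) (g y)%:E =
    (if x < c * t then Z n.+1 * (tail_poly (c * t) n.+1).[Num.max x 0] else 0)%:E)%E.
  rewrite (_ : (fun y => _) = (fun y => (q^`().[y])%:E) \_ `[0, c * t[); last first.
    apply/funext => y; rewrite patchE /g indicE.
    by case: (boolP (y \in _)) => _; rewrite ?mulr1 ?mulr0.
  rewrite -integral_mkcondr.
  have -> : `[x, +oo[ `&` `[0, c * t[ = `[Num.max x 0, c * t[%classic.
    apply/seteqP; split=> y; rewrite /= !in_itv/= andbT ge_max.
      by case=> -> /andP[-> ->].
    by move=> /andP[/andP[-> ->] ->].
  have ct0 : 0 <= c * t by rewrite mulr_ge0// ltW.
  have [xc|cx] := ltP x (c * t); last first.
    by rewrite set_itv_ge ?integral_set0// bnd_simp -leNgt le_max cx.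
  rewrite integral_itv_bndo_bndc; last first.
    apply/measurable_EFinP; apply: measurable_funTS.
    by apply: continuous_measurable_fun; exact: continuous_horner.
  rewrite integral_horner_deriv; last by rewrite ge_max ct0 ltW.
  by rewrite /q !(hornerZ _ (tail_poly _ _)) tail_poly_last; congr EFin; ring.
have key : P (G n.+1 `&` T @^-1` A) =
    ((Z n.+1)%:E * \int[lebesgue_measure]_(x in A) (f x * \1_`[0, c * t[ x)%:E)%E.
  rewrite -ge0_integralZl_EFin//; last 3 first.
  - by move=> x _; rewrite lee_fin.
  - apply/measurable_EFinP; apply: measurable_funTS.
    rewrite (_ : (fun _ => _) = (fun x => (Z n.+1)^-1 * g x)); last first.
      by apply/funext => x; rewrite gE mulKf// gt_eqF.
    exact: measurable_funM.
  - exact: ltW.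
  under eq_integral do rewrite -EFinM -gE.
  apply: (@finite_measure_eq_on_rays _ (restricted_law P (mG n.+1) mT)
    (density_measure mg g_ge0)) => // x.
    exact: etrans (probability_ray n x) (esym (g_ray x)).
  have : (P (G n.+1 `&` T @^-1` `[x, +oo[%classic) < +oo)%E.
    by rewrite probability_ray ltry.
  exact.
rewrite /meander_law /cond_prob PB probability_conditioned//.
have Pfin : P (G n.+1 `&` T @^-1` A) \is a fin_num.
  by rewrite fin_num_measure//; apply: measurableI; [exact: mG|exact: mTA].
rewrite key in Pfin *.
(* An infinite integral, multiplied by the positive [Z n.+1], would contradict the finiteness of the
   probability. *)
case: (integral _ _ _) Pfin => [r _|/=|/=].
- by congr EFin; rewrite /= mulrC mulKf// gt_eqF.
- by rewrite gt0_muley// lte_fin.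
- by rewrite gt0_muleNy// lte_fin.
Qed.

(** Without jumps the process equals [c * t] on the whole of [G 0], so the numerator is the
    probability of [G 0] or of the empty set. *)
Lemma meander_law0 A : measurable A -> meander_law V0 N t 0 A = \d_(c * t) A.
Proof.
move=> mA; rewrite /meander_law /cond_prob PB probability_conditioned//.
have TE w : G 0%N w -> T w = c * t.
  case=> /= V [Nt _ _]; rewrite (telegraphE _ N_poisson) V.
  have N0t : N 0 w = N t w by rewrite Nt (poisson_start N_poisson).
  have := alternating_integral_const (poisson_counting_path N_poisson w) (lexx _) (ltW t_gt0) N0t.
  by rewrite alternating_integral0 Nt expr0 mul1r !subr0 => ->.
rewrite diracE; have [ctA|ctA] := boolP (c * t \in A).
  rewrite (_ : _ `&` _ = G 0%N) ?PG; last first.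
    by apply/seteqP; split=> [w []//|w Gw]; split=> //=; rewrite TE//; exact: set_mem.
  by rewrite /= divff// gt_eqF.
rewrite (_ : _ `&` _ = set0) ?measure0 /= ?mul0r//.
apply/seteqP; split=> // w [Gw]; rewrite /= TE// => ctA'.
by move/negP: ctA; apply; exact: mem_set.
Qed.

End meander_law_formula.

Theorem mainTheorem9 (d : measure_display) (Omega : measurableType d)
    (R : realType) (P : probability Omega R)
    (lambda c t : R) (V0 : {RV P >-> R}) (N : R -> {RV P >-> nat})
    (lambda_gt0 : 0 < lambda) (c_gt0 : 0 < c) (t_gt0 : 0 < t)
    (N_poisson : poisson_process lambda N)
    (V0_uniform : uniform_sign c V0)
    (V0_N_independent : independent_of_process V0 N) :
  [/\ forall A : set R, measurable A ->
        meander_law V0 N t 0 A = \d_(c * t) A,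
      forall (k : nat) (A : set R), (1 <= k)%N -> measurable A ->
        meander_law V0 N t (2 * k) A =
        (\int[lebesgue_measure]_(x in A)
          ((2 * k)%:R * x
             * ((c ^+ 2 * t ^+ 2 - x ^+ 2) ^+ (k - 1) / (c * t) ^+ (2 * k))
             * \1_`[0, c * t[ x)%:E)%E
    & forall (k : nat) (A : set R), measurable A ->
        meander_law V0 N t (2 * k + 1) A =
        (\int[lebesgue_measure]_(x in A)
          ((c * t + (2 * k + 1)%:R * x) / (c * t) ^+ (2 * k + 1)
             * ((c ^+ 2 * t ^+ 2 - x ^+ 2) ^+ k / (c * t + x))
             * \1_`[0, c * t[ x)%:E)%E].
Proof.
have ct0 : 0 < c * t by rewrite mulr_gt0.
have sq_ge0 x : 0 <= x -> x < c * t -> 0 <= (c * t) ^+ 2 - x ^+ 2.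
  by move=> x0 xc; rewrite subr_ge0 lerXn2r ?nnegrE// ltW.
rewrite -exprMn; split.
- by move=> A mA; exact: (meander_law0 lambda_gt0 c_gt0 t_gt0 N_poisson V0_uniform V0_N_independent).
- move=> [//|k] A _ mA; rewrite subn1 /=.
  (* The density lemma is stated for a successor number of jumps. *)
  rewrite -[in LHS](prednK (_ : 0 < 2 * k.+1)%N)//.
  apply: (meander_law_density lambda_gt0 c_gt0 t_gt0
    N_poisson V0_uniform V0_N_independent) => // x x0 xc.
    by rewrite -tail_poly_deriv_even.
  by rewrite !mulr_ge0 ?invr_ge0 ?exprn_ge0 ?sq_ge0// ltW.
- move=> k A mA; rewrite {1}addn1.
  apply: (meander_law_density lambda_gt0 c_gt0 t_gt0
    N_poisson V0_uniform V0_N_independent) => // x x0 xc.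
    by rewrite -tail_poly_deriv_odd ?addn1// gt_eqF// ltr_pwDl.
  by rewrite !mulr_ge0 ?invr_ge0 ?exprn_ge0 ?sq_ge0 ?addr_ge0 ?mulr_ge0 ?(ltW c_gt0) ?(ltW t_gt0).
Qed.
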